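(* Let $\mathfrak{P}$ be a compactness-like topological property and let $X$ and $Y$ be locally compact, locally-$\mathfrak{P}$ spaces, neither of which has $\mathfrak{P}$. If $(\mathscr{E}_\mathfrak{P}(X),\leq)$ and $(\mathscr{E}_\mathfrak{P}(Y),\leq)$ are order-isomorphic, then $\lambda_\mathfrak{P}X\setminus X$ and $\lambda_\mathfrak{P}Y\setminus Y$ are homeomorphic.
   Context: All spaces are completely regular Hausdorff; $\beta X$ is the Stone–Čech compactification. An extension of $X$ is a space containing $X$ as a dense subspace; its remainder is $Y\setminus X$. Extensions are identified up to homeomorphisms fixing $X$ pointwise, and $Y\leq Y'$ means there is a continuous map $Y'\to Y$ fixing $X$ pointwise. $\mathscr{E}_\mathfrak{P}(X)$ is the set of all extensions of $X$ with $\mathfrak{P}$ and compact remainder, ordered by $\leq$. $X$ is locally-$\mathfrak{P}$ if each point has an open neighborhood whose closure has $\mathfrak{P}$. $\mathrm{Coz}(X)$ is the set of cozero-sets of $X$. $\lambda_\mathfrak{P}X=\bigcup\{\mathrm{int}_{\beta X}\mathrm{cl}_{\beta X}C: C\in\mathrm{Coz}(X),\ \mathrm{cl}_XC\text{ has }\mathfrak{P}\}$. A topological property is compactness-like if it is hereditary to clopen subspaces, finitely additive (finite disjoint unions of closed subspaces with $\mathfrak{P}$ have $\mathfrak{P}$), invariant and inverse invariant under perfect surjections, and satisfies Mrówka's condition (W): if a space $Z$ has a point $p$ with an open base $\mathscr{B}$ at $p$ such that $Z\setminus B$ has $\mathfrak{P}$ for all $B\in\mathscr{B}$, then $Z$ has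 $\mathfrak{P}$. *)

(* Defs.v *)
From Stdlib Require Import Reals Lra List Classical.
Set Implicit Arguments.

Record Top := mkTop {
  pt :> Type;
  isOpen : (pt -> Prop) -> Prop;
  open_full : isOpen (fun _ => True);
  open_inter : forall U V, isOpen U -> isOpen V -> isOpen (fun x => U x /\ V x);
  open_union : forall F : (pt -> Prop) -> Prop,
      (forall U, F U -> isOpen U) -> isOpen (fun x => exists U, F U /\ U x)
}.
Arguments isOpen {t} _.

Section Basic.
Variable X : Top.
Definition closed (A : X -> Prop) := isOpen (fun x => ~ A x).
Definition closure (A : X -> Prop) : X -> Prop :=
  fun x => forall C, closed C -> (forall y, A y -> C y) -> C x.
Definition interior (A : X -> Prop) : X -> Prop :=
  fun x => exists U, isOpen U /\ U x /\ forall y, U y -> A y.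
Definition dense (A : X -> Prop) := forall x, closure A x.
Definition compact : Prop :=
  forall F : (X -> Prop) -> Prop, (forall U, F U -> isOpen U) ->
    (forall x, exists U, F U /\ U x) ->
    exists l : list (X -> Prop), (forall U, In U l -> F U) /\
      forall x, exists U, In U l /\ U x.
Definition hausdorff : Prop :=
  forall x y : X, x <> y -> exists U V, isOpen U /\ isOpen V /\ U x /\ V y /\
    forall z, ~ (U z /\ V z).
End Basic.
Arguments compact X : clear implicits.
Arguments hausdorff X : clear implicits.
Arguments closed {X} A.
Arguments closure {X} A _.
Arguments interior {X} A _.
Arguments dense {X} A.

Section Sub.
Variables (X : Top) (A : X -> Prop).
Definition sub_open (V : {x | A x} -> Prop) :=
  forall x, V x -> exists U, isOpen U /\ U (proj1_sig x) /\
     forall y : {x | A x}, U (proj1_sig y) -> V y.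
Lemma sub_full : sub_open (fun _ => True).
Proof. intros x _. exists (fun _ => True). split; [apply open_full|auto]. Qed.
Lemma sub_inter U V : sub_open U -> sub_open V -> sub_open (fun x => U x /\ V x).
Proof.
  intros HU HV x [Ux Vx]. destruct (HU x Ux) as [U1 [o1 [a1 b1]]].
  destruct (HV x Vx) as [V1 [o2 [a2 b2]]].
  exists (fun z => U1 z /\ V1 z). split; [apply open_inter; auto|].
  split; [auto|]. intros y [c d]; auto.
Qed.
Lemma sub_union (F : ({x | A x} -> Prop) -> Prop) :
  (forall U, F U -> sub_open U) -> sub_open (fun x => exists U, F U /\ U x).
Proof.
  intros H x [U [FU Ux]]. destruct (H U FU x Ux) as [W [oW [a b]]].
  exists W. split; auto. split; auto. intros y Wy. exists U; auto.
Qed.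
Definition subspace : Top := @mkTop {x | A x} sub_open sub_full sub_inter sub_union.
End Sub.
Arguments subspace {X} A.

Definition R_open (U : R -> Prop) :=
  forall x, U x -> exists eps, (0 < eps)%R /\ forall y, (Rabs (y - x) < eps)%R -> U y.
Lemma R_full : R_open (fun _ => True).
Proof. intros x _. exists 1%R. split; [lra|auto]. Qed.
Lemma R_inter U V : R_open U -> R_open V -> R_open (fun x => U x /\ V x).
Proof.
  intros HU HV x [Ux Vx]. destruct (HU x Ux) as [e1 [p1 h1]].
  destruct (HV x Vx) as [e2 [p2 h2]]. exists (Rmin e1 e2). split.
  - apply Rmin_pos; auto.
  - intros y Hy. split; [apply h1|apply h2];
      eapply Rlt_le_trans; eauto; [apply Rmin_l|apply Rmin_r].
Qed.
Lemma R_union (F : (R -> Prop) -> Prop) :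
  (forall U, F U -> R_open U) -> R_open (fun x => exists U, F U /\ U x).
Proof.
  intros H x [U [FU Ux]]. destruct (H U FU x Ux) as [e [p h]].
  exists e. split; auto. intros y Hy. exists U; auto.
Qed.
Definition R_top : Top := @mkTop R R_open R_full R_inter R_union.

Definition continuous {X Y : Top} (f : X -> Y) :=
  forall V, isOpen V -> isOpen (fun x => V (f x)).

Definition completely_regular (X : Top) :=
  forall (A : X -> Prop) (x : X), closed A -> ~ A x ->
    exists f : X -> R_top, continuous f /\ f x = 0%R /\
      (forall y, A y -> f y = 1%R) /\ (forall y, (0 <= f y <= 1)%R).

Definition tychonoff (X : Top) := hausdorff X /\ completely_regular X.

Definition homeomorphic (X Y : Top) :=
  exists (f : X -> Y) (g : Y -> X), continuous f /\ continuous g /\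
    (forall x, g (f x) = x) /\ (forall y, f (g y) = y).

Definition image {X Y : Top} (e : X -> Y) : Y -> Prop := fun y => exists x, e x = y.

Definition embedding {X Y : Top} (e : X -> Y) :=
  continuous e /\ (forall x x', e x = e x' -> x = x') /\
  forall U, isOpen U -> exists V, isOpen V /\ forall x, U x <-> V (e x).

Record Ext (X : Top) := mkExt { ext_sp : Top; ext_emb : X -> ext_sp }.
Arguments ext_sp {X} _.
Arguments ext_emb {X} _ _.

Definition is_extension {X : Top} (E : Ext X) :=
  tychonoff (ext_sp E) /\ embedding (ext_emb E) /\ dense (image (ext_emb E)).

Definition remainder {X : Top} (E : Ext X) : Top :=
  subspace (fun y : ext_sp E => ~ image (ext_emb E) y).

Definition in_EP (P : Top -> Prop) {X : Top} (E : Ext X) :=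
  is_extension E /\ P (ext_sp E) /\ compact (remainder E).

Definition ext_le {X : Top} (E1 E2 : Ext X) :=
  exists g : ext_sp E2 -> ext_sp E1, continuous g /\
    forall x, g (ext_emb E2 x) = ext_emb E1 x.

Definition ext_equiv {X : Top} (E1 E2 : Ext X) :=
  exists (h : ext_sp E1 -> ext_sp E2) (k : ext_sp E2 -> ext_sp E1),
    continuous h /\ continuous k /\ (forall y, k (h y) = y) /\
    (forall y, h (k y) = y) /\ forall x, h (ext_emb E1 x) = ext_emb E2 x.

(* (𝓔_𝔓(X), <=) and (𝓔_𝔓(Y), <=) are order-isomorphic, where extensions
   are identified up to ext_equiv: a map on representatives that is well
   defined and injective on classes, preserves and reflects <=, and is
   surjective on classes. *)
Definition EP_order_isomorphic (P : Top -> Prop) (X Y : Top) :=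
  exists Phi : Ext X -> Ext Y,
    (forall A, in_EP P A -> in_EP P (Phi A)) /\
    (forall A A', in_EP P A -> in_EP P A' ->
        (ext_equiv A A' <-> ext_equiv (Phi A) (Phi A'))) /\
    (forall A A', in_EP P A -> in_EP P A' ->
        (ext_le A A' <-> ext_le (Phi A) (Phi A'))) /\
    (forall B, in_EP P B -> exists A, in_EP P A /\ ext_equiv (Phi A) B).

Definition is_stone_cech {X B : Top} (e : X -> B) :=
  compact B /\ hausdorff B /\ embedding e /\ dense (image e) /\
  forall (K : Top) (f : X -> K), compact K -> hausdorff K -> continuous f ->
    exists g : B -> K, continuous g /\ forall x, g (e x) = f x.

Definition perfect_surj {X Y : Top} (f : X -> Y) :=
  continuous f /\ (forall y, exists x, f x = y) /\
  (forall A : X -> Prop, closed A -> closed (fun y => exists x, A x /\ f x = y)) /\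
  (forall y, compact (subspace (fun x => f x = y))).

Definition compactness_like (P : Top -> Prop) :=
  (forall X : Top, tychonoff X -> P X ->
     forall C : X -> Prop, isOpen C -> closed C -> P (subspace C)) /\
  (forall (X : Top) (n : nat) (A : nat -> X -> Prop), tychonoff X ->
     (forall i, (i < n)%nat -> closed (A i) /\ P (subspace (A i))) ->
     (forall i j x, (i < n)%nat -> (j < n)%nat -> A i x -> A j x -> i = j) ->
     (forall x, exists i, (i < n)%nat /\ A i x) -> P X) /\
  (forall (X Y : Top) (f : X -> Y), tychonoff X -> tychonoff Y ->
     perfect_surj f -> (P X <-> P Y)) /\
  (* Mrówka's condition (W) *)
  (forall (Z : Top) (p : Z) (Bs : (Z -> Prop) -> Prop), tychonoff Z ->
     (forall B, Bs B -> isOpen B /\ B p) ->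
     (forall U, isOpen U -> U p -> exists B, Bs B /\ forall z, B z -> U z) ->
     (forall B, Bs B -> P (subspace (fun z => ~ B z))) ->
     P Z).

Definition locally_compact (X : Top) :=
  forall x : X, exists U, isOpen U /\ U x /\ compact (subspace (closure U)).

Definition locally_P (P : Top -> Prop) (X : Top) :=
  forall x : X, exists U, isOpen U /\ U x /\ P (subspace (closure U)).

Definition cozero {X : Top} (C : X -> Prop) :=
  exists f : X -> R_top, continuous f /\ forall x, C x <-> f x <> 0%R.

(* λ_𝔓 X computed inside a Stone–Čech compactification (B, e) of X *)
Definition lambdaP (P : Top -> Prop) {X B : Top} (e : X -> B) : B -> Prop :=
  fun p => exists C : X -> Prop, cozero C /\ P (subspace (closure C)) /\
    interior (closure (fun q => exists x, C x /\ e x = q)) p.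

Definition lambda_remainder (P : Top -> Prop) {X B : Top} (e : X -> B) : Top :=
  subspace (fun p : B => lambdaP P e p /\ ~ image e p).

(* Main.v *)
(** Let B be the Stone-Čech compactification of X, M the complement of lambda_P X in B, and
    L = lambda_P X minus X. A member E of E_P(X) amounts to a compact set K with
    M ⊆ K ⊆ B minus X (the points of B at which the inclusion X -> E has a limit outside X)
    together with the partition of K into the fibres of the limit map, and E ≤ E' holds iff
    K' ⊆ K and the partition of K' refines that of K. The largest element is M with the discrete
    partition; the elements just below it either identify two points of M or add a single point
    q of L to M. The latter are exactly the elements c for which some b has {b, c, top} as the
    interval from b to the top: for M + q, let b identify q with a point of M, which exists since
    X fails P. So the order recovers the points of L; and it recovers the closed sets of L,
    because these are the traces K ∩ L, that is, the sets of q with E ≤ M + q. *)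

From Stdlib Require Import Reals Lra Lia List Wf_nat Classical ClassicalEpsilon
  FunctionalExtensionality PropExtensionality.
Require Import Defs.

(** * General topology *)

(** Only two quotients of B are ever formed besides X ∪ K itself: one glues a pair of points, the
    other collapses all of K. The second settles why an admissible quotient has P. In the quotient
    with K collapsed to one point, the complement of an open neighbourhood of that point is a closed
    part of X lying in a compact subset of lambda_P X, so it has P by a finite cover; condition (W)
    then gives P to this quotient, and perfect maps carry P back to X ∪ K and on to any other
    quotient of it.

    A coatom that glues two points of M is ruled out because the elements below it always leave more
    room: if b is strictly below it, then either b has a limit at some q in L and lies below M + q,
    or b glues a pair that the coatom keeps apart and lies below M with that pair glued. Neither of
    these is below the coatom. *)

Lemma open_ext {X : Top} (U V : X -> Prop) :
  isOpen U -> (forall x, U x <-> V x) -> isOpen V.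
Proof.
  intros HU H. replace V with U; auto.
  apply functional_extensionality; intro x. apply propositional_extensionality; auto.
Qed.

Lemma open_local {X : Top} (U : X -> Prop) :
  (forall x, U x -> exists V, isOpen V /\ V x /\ forall y, V y -> U y) -> isOpen U.
Proof.
  intros H.
  apply open_ext with
    (fun x => exists V, (isOpen V /\ forall y, V y -> U y) /\ V x).
  - apply (open_union X (fun V => isOpen V /\ forall y, V y -> U y)). tauto.
  - intro x; split.
    + intros (V & [_ h] & Vx); auto.
    + intro Ux. destruct (H x Ux) as (V & oV & Vx & h). exists V; auto.
Qed.

Lemma open_empty {X : Top} : isOpen (fun _ : X => False).
Proof. apply open_local; tauto. Qed.

Lemma open_or {X : Top} (U V : X -> Prop) :
  isOpen U -> isOpen V -> isOpen (fun x => U x \/ V x).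
Proof.
  intros oU oV. apply open_local. intros x [h|h]; [exists U|exists V]; auto.
Qed.

Lemma closed_ext {X : Top} (A C : X -> Prop) :
  closed A -> (forall x, A x <-> C x) -> closed C.
Proof. intros cA H. eapply open_ext; [exact cA|]. intro x; cbn. rewrite H; tauto. Qed.

Lemma closed_compl {X : Top} (U : X -> Prop) : isOpen U -> closed (fun x => ~ U x).
Proof.
  intro oU. eapply open_ext; [exact oU|]. intro x; cbn. split; [tauto|apply NNPP].
Qed.

Lemma closed_or {X : Top} (A C : X -> Prop) :
  closed A -> closed C -> closed (fun x => A x \/ C x).
Proof.
  intros cA cC. eapply open_ext; [exact (open_inter X _ _ cA cC)|]. intro; cbn; tauto.
Qed.

Lemma closed_and {X : Top} (A C : X -> Prop) :
  closed A -> closed C -> closed (fun x => A x /\ C x).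
Proof.
  intros cA cC. eapply open_ext; [exact (open_or _ _ cA cC)|]. intro; cbn; tauto.
Qed.

Lemma closed_closure {X : Top} (A : X -> Prop) : closed (closure A).
Proof.
  apply open_local. intros x Hx. apply not_all_ex_not in Hx. destruct Hx as [C HC].
  apply imply_to_and in HC. destruct HC as [cC HC].
  apply imply_to_and in HC. destruct HC as [HA Cx].
  exists (fun y => ~ C y). split; [exact cC|]. split; [exact Cx|].
  intros y Cy h. apply Cy, h; auto.
Qed.

Lemma subset_closure {X : Top} (A : X -> Prop) x : A x -> closure A x.
Proof. intros Ax C _ h; auto. Qed.

Lemma closure_min {X : Top} (A C : X -> Prop) :
  closed C -> (forall y, A y -> C y) -> forall x, closure A x -> C x.
Proof. intros cC h x Hx. apply Hx; auto. Qed.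

Lemma closure_nbhd {X : Top} (A : X -> Prop) x :
  closure A x <-> forall U, isOpen U -> U x -> exists y, U y /\ A y.
Proof.
  split.
  - intros H U oU Ux. apply NNPP; intro n.
    assert (h : ~ U x); [|tauto].
    apply H; [apply closed_compl; auto|]. intros y Ay Uy. apply n; exists y; auto.
  - intros H C cC h. apply NNPP; intro n. destruct (H _ cC n) as (y & ny & Ay). auto.
Qed.

Lemma sig_eq {T : Type} {A : T -> Prop} (x y : {t | A t}) :
  proj1_sig x = proj1_sig y -> x = y.
Proof.
  destruct x as [x hx], y as [y hy]; cbn; intros ->. f_equal. apply proof_irrelevance.
Qed.

Definition incl {X : Top} (A : X -> Prop) : subspace A -> X := @proj1_sig _ _.

Lemma continuous_comp {X Y Z : Top} (f : X -> Y) (g : Y -> Z) :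
  continuous f -> continuous g -> continuous (fun x => g (f x)).
Proof. intros cf cg V oV. exact (cf _ (cg _ oV)). Qed.

Lemma continuous_closed {X Y : Top} (f : X -> Y) (C : Y -> Prop) :
  continuous f -> closed C -> closed (fun x => C (f x)).
Proof. intros cf cC. exact (cf _ cC). Qed.

Lemma incl_continuous {X : Top} (A : X -> Prop) : continuous (incl A).
Proof. intros V oV x Vx. exists V; auto. Qed.

(** Openness in [subspace] is given by a witness around each point; the union of all witnesses is a
    single open set with trace [V]. *)
Lemma sub_open_trace {X : Top} (A : X -> Prop) (V : subspace A -> Prop) :
  isOpen V -> exists U, isOpen U /\ forall z, V z <-> U (proj1_sig z).
Proof.
  intro oV.
  exists (fun x => exists U, (isOpen U /\ forall z : subspace A, U (proj1_sig z) -> V z) /\ U x).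
  split.
  - apply (open_union X (fun U => isOpen U /\ forall z : subspace A, U (proj1_sig z) -> V z)).
    tauto.
  - intro z; split.
    + intro Vz. destruct (oV z Vz) as (U & oU & Uz & h). exists U; auto.
    + intros (U & [_ h] & Uz); auto.
Qed.

Lemma sub_closed_trace {X : Top} (A : X -> Prop) (C : subspace A -> Prop) :
  closed C -> exists D, closed D /\ forall z, C z <-> D (proj1_sig z).
Proof.
  intro cC. destruct (sub_open_trace _ _ cC) as (U & oU & h).
  exists (fun x => ~ U x). split; [apply closed_compl; auto|].
  intro z. rewrite <- h. split; [tauto|apply NNPP].
Qed.

Lemma continuous_into_sub {X Y : Top} (A : Y -> Prop) (f : X -> subspace A) :
  continuous (fun x => proj1_sig (f x) : Y) -> continuous f.
Proof.
  intros cf V oV. destruct (sub_open_trace _ _ oV) as (U & oU & h).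
  eapply open_ext; [exact (cf U oU)|]. intro x; cbn. rewrite h; tauto.
Qed.

Lemma incl_embedding {X : Top} (A : X -> Prop) : embedding (incl A).
Proof.
  split; [apply incl_continuous|]. split; [intros x y; apply sig_eq|].
  intros U oU. destruct (sub_open_trace _ _ oU) as (V & oV & h). exists V; auto.
Qed.

Lemma embedding_comp {X Y Z : Top} (f : X -> Y) (g : Y -> Z) :
  embedding f -> embedding g -> embedding (fun x => g (f x)).
Proof.
  intros (cf & jf & of) (cg & jg & og). split; [apply continuous_comp; auto|].
  split; [auto|]. intros U oU. destruct (of U oU) as (V & oV & hV).
  destruct (og V oV) as (W & oW & hW). exists W; split; auto.
  intro x. rewrite hV, hW; tauto.
Qed.

Lemma id_continuous (X : Top) : continuous (fun x : X => x).
Proof. intros V oV; exact oV. Qed.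

Lemma id_embedding (X : Top) : embedding (fun x : X => x).
Proof.
  split; [apply id_continuous|]. split; [auto|]. intros U oU; exists U; split; [auto|tauto].
Qed.

Lemma hausdorff_embedding {X Y : Top} (f : X -> Y) :
  embedding f -> hausdorff Y -> hausdorff X.
Proof.
  intros (cf & jf & _) hY x y n.
  destruct (hY (f x) (f y)) as (U & V & oU & oV & Ux & Vy & d); [auto|].
  exists (fun x => U (f x)), (fun x => V (f x)).
  split; [apply cf; auto|]. split; [apply cf; auto|]. split; [auto|]. split; [auto|].
  intro z; apply d.
Qed.

Lemma tychonoff_embedding {X Y : Top} (f : X -> Y) :
  embedding f -> tychonoff Y -> tychonoff X.
Proof.
  intros ef [hY rY]. split; [eapply hausdorff_embedding; eauto|].
  destruct ef as (cf & jf & of). intros A x cA nA.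
  destruct (of _ cA) as (V & oV & hV).
  destruct (rY (fun y => ~ V y) (f x)) as (g & cg & g0 & g1 & g01).
  - apply closed_compl; auto.
  - intro n. apply n, hV; auto.
  - exists (fun x => g (f x)). split; [apply continuous_comp; auto|].
    split; [auto|]. split; [|auto]. intros y Ay. apply g1. rewrite <- hV. tauto.
Qed.

Lemma tychonoff_sub {X : Top} (A : X -> Prop) : tychonoff X -> tychonoff (subspace A).
Proof. apply (tychonoff_embedding (incl A)), incl_embedding. Qed.

Lemma point_closed {X : Top} (p : X) : hausdorff X -> closed (fun x => x = p).
Proof.
  intro hX. apply open_local. intros x n.
  destruct (hX x p n) as (U & V & oU & oV & Ux & Vp & d).
  exists U. split; [auto|]. split; [auto|]. intros y Uy ->. apply (d p); auto.
Qed.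

(** * Compactness *)

(** Compactness as an induction over ideals of subsets: the open members of [J] cover [X], and
    finitely many of them are merged by the union rule. Later arguments choose [J] and need no
    finite lists. *)
Lemma compact_ind {X : Top} (J : (X -> Prop) -> Prop) :
  compact X ->
  J (fun _ => False) ->
  (forall U V, J U -> J V -> J (fun x => U x \/ V x)) ->
  (forall U V : X -> Prop, (forall x, U x -> V x) -> J V -> J U) ->
  (forall x, exists U, isOpen U /\ U x /\ J U) ->
  J (fun _ => True).
Proof.
  intros cX J0 JU JS Jl.
  destruct (cX (fun U => isOpen U /\ J U)) as (l & Hl & cov).
  - tauto.
  - intro x. destruct (Jl x) as (U & oU & Ux & JU'). exists U; auto.
  - apply JS with (fun x => exists U, In U l /\ U x); [auto|]. clear cov.
    induction l as [|U l IH].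
    + apply JS with (fun _ => False); [|auto]. intros x (U & [] & _).
    + apply JS with (fun x => U x \/ exists V, In V l /\ V x).
      * intros x (V & [<-|h] & Vx); [left; auto|right; exists V; auto].
      * apply JU; [apply Hl; left; auto|]. apply IH. intros V h; apply Hl; right; auto.
Qed.

(** Converse of [compact_ind]: take for [J] the ideal of sets covered by finitely many members of
    the given cover. *)
Lemma compact_of_ind (X : Top) :
  (forall J : (X -> Prop) -> Prop,
     J (fun _ => False) ->
     (forall U V, J U -> J V -> J (fun x => U x \/ V x)) ->
     (forall U V : X -> Prop, (forall x, U x -> V x) -> J V -> J U) ->
     (forall x, exists U, isOpen U /\ U x /\ J U) ->
     J (fun _ => True)) ->
  compact X.
Proof.
  intros H F oF cov.
  destruct (H (fun W => exists l, (forall U, In U l -> F U) /\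
                 forall x, W x -> exists U, In U l /\ U x)) as (l & h1 & h2).
  - exists nil. split; [intros U []|tauto].
  - intros U V (l & a & b) (l' & a' & b'). exists (l ++ l'). split.
    + intros W h. apply in_app_or in h. destruct h; auto.
    + intros x [h|h]; [destruct (b x h) as (W & h1 & h2)|destruct (b' x h) as (W & h1 & h2)];
        exists W; split; auto; apply in_or_app; auto.
  - intros U V s (l & a & b). exists l; auto.
  - intro x. destruct (cov x) as (U & FU & Ux). exists U. split; [auto|]. split; [auto|].
    exists (U :: nil). split; [intros V [<-|[]]; auto|].
    intros y Uy; exists U; split; [left|]; auto.
  - exists l; split; auto.
Qed.

Lemma compact_image {X Y : Top} (f : X -> Y) :
  continuous f -> (forall y, exists x, f x = y) -> compact X -> compact Y.
Proof.
  intros cf sf cX. apply compact_of_ind. intros J J0 JU JS Jl.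
  apply JS with (fun y => exists x, True /\ f x = y).
  { intros y _. destruct (sf y) as [x h]; exists x; auto. }
  apply (compact_ind (fun U => J (fun y => exists x, U x /\ f x = y))); auto.
  - apply JS with (fun _ => False); [firstorder|auto].
  - intros U V hU hV. eapply JS; [|exact (JU _ _ hU hV)].
    intros y (x & [h|h] & e); [left|right]; exists x; auto.
  - intros U V s. apply JS. intros y (x & h & e); exists x; auto.
  - intro x. destruct (Jl (f x)) as (U & oU & Ux & JU'). exists (fun x => U (f x)).
    split; [apply cf; auto|]. split; [auto|]. eapply JS; [|exact JU'].
    intros y (z & h & <-); auto.
Qed.

Lemma compact_closed_sub {X : Top} (A : X -> Prop) :
  compact X -> closed A -> compact (subspace A).
Proof.
  intros cX cA. apply compact_of_ind. intros J J0 JU JS Jl.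
  apply JS with (fun z => True /\ A (proj1_sig z)); [intros [z h]; auto|].
  apply (compact_ind (fun U => J (fun z => U (proj1_sig z) /\ A (proj1_sig z)))); auto.
  - apply JS with (fun _ => False); [firstorder|auto].
  - intros U V hU hV. eapply JS; [|exact (JU _ _ hU hV)]. cbn. tauto.
  - intros U V s. apply JS. intros z []; auto.
  - intro x. destruct (classic (A x)) as [Ax|nA].
    + destruct (Jl (exist _ x Ax)) as (U & oU & Ux & JU').
      destruct (sub_open_trace _ _ oU) as (V & oV & h). exists V.
      split; [auto|]. split; [apply (h (exist _ x Ax)); auto|].
      eapply JS; [|exact JU']. intros z [Vz _]. apply h; auto.
    + exists (fun x => ~ A x). split; [exact cA|]. split; [auto|].
      apply JS with (fun _ => False); [tauto|auto].
Qed.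

(** Serves for fibres: those of a bijective embedding have one point, those of a copairing of two
    injections at most two. *)
Lemma compact_at_most_two (X : Top) (a b : X) :
  (forall x, x = a \/ x = b) -> compact X.
Proof.
  intro H. apply compact_of_ind. intros J J0 JU JS Jl.
  destruct (Jl a) as (U & _ & Ua & hU), (Jl b) as (V & _ & Vb & hV).
  apply JS with (fun x => U x \/ V x); [|auto].
  intros x _. destruct (H x) as [->| ->]; auto.
Qed.

Lemma compact_hausdorff_point_separation {X : Top} (A : X -> Prop) (x : X) :
  compact X -> hausdorff X -> closed A -> ~ A x ->
  exists U V, isOpen U /\ isOpen V /\ U x /\ (forall y, A y -> V y) /\
    forall z, ~ (U z /\ V z).
Proof.
  intros cX hX cA nA.
  destruct (compact_ind (fun W => exists U V, isOpen U /\ isOpen V /\ U x /\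
              (forall y, W y -> A y -> V y) /\ forall z, ~ (U z /\ V z)) cX)
    as (U & V & oU & oV & Ux & h & d).
  - exists (fun _ => True), (fun _ => False).
    split; [apply open_full|]. split; [apply open_empty|]. tauto.
  - intros W W' (U & V & oU & oV & Ux & h & d) (U' & V' & oU' & oV' & Ux' & h' & d').
    exists (fun z => U z /\ U' z), (fun z => V z \/ V' z).
    split; [apply open_inter; auto|]. split; [apply open_or; auto|].
    split; [auto|]. split; [intros y []; auto|]. intro z; specialize (d z); specialize (d' z); tauto.
  - intros W W' s (U & V & oU & oV & Ux & h & d). exists U, V. intuition.
  - intro y. destruct (classic (A y)) as [Ay|nAy].
    + destruct (hX x y) as (U & V & oU & oV & Ux & Vy & d); [intros ->; auto|].
      exists V. split; [auto|]. split; [auto|]. exists U, V. auto 10.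
    + exists (fun y => ~ A y). split; [exact cA|]. split; [auto|].
      exists (fun _ => True), (fun _ => False).
      split; [apply open_full|]. split; [apply open_empty|]. tauto.
  - exists U, V. auto 10.
Qed.

Lemma compact_hausdorff_normal {X : Top} (A C : X -> Prop) :
  compact X -> hausdorff X -> closed A -> closed C -> (forall x, ~ (A x /\ C x)) ->
  exists U V, isOpen U /\ isOpen V /\ (forall y, A y -> U y) /\ (forall y, C y -> V y) /\
    forall z, ~ (U z /\ V z).
Proof.
  intros cX hX cA cC dis.
  destruct (compact_ind (fun W => exists U V, isOpen U /\ isOpen V /\
      (forall y, W y -> A y -> U y) /\ (forall y, C y -> V y) /\ forall z, ~ (U z /\ V z)) cX)
    as (U & V & oU & oV & h & h2 & d).
  - exists (fun _ => False), (fun _ => True).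
    split; [apply open_empty|]. split; [apply open_full|]. tauto.
  - intros W W' (U & V & oU & oV & a & h & d) (U' & V' & oU' & oV' & a' & h' & d').
    exists (fun z => U z \/ U' z), (fun z => V z /\ V' z).
    split; [apply open_or; auto|]. split; [apply open_inter; auto|].
    split; [intros y []; auto|]. split; [auto|].
    intro z; specialize (d z); specialize (d' z); tauto.
  - intros W W' s (U & V & oU & oV & a & h & d). exists U, V. intuition.
  - intro y. destruct (classic (A y)) as [Ay|nAy].
    + destruct (compact_hausdorff_point_separation C y)
        as (U & V & oU & oV & Uy & h & d); auto.
      { intro Cy; apply (dis y); auto. }
      exists U. split; [auto|]. split; [auto|]. exists U, V. auto 10.
    + exists (fun y => ~ A y). split; [exact cA|]. split; [auto|].
      exists (fun _ => False), (fun _ => True).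
      split; [apply open_empty|]. split; [apply open_full|]. tauto.
  - exists U, V. auto 10.
Qed.

Lemma compact_closed {X : Top} (A : X -> Prop) :
  hausdorff X -> compact (subspace A) -> closed A.
Proof.
  intros hX cA. apply open_local. intros x nA.
  destruct (compact_ind (fun W : subspace A -> Prop => exists U : X -> Prop,
     isOpen U /\ U x /\ forall z, W z -> ~ U (proj1_sig z)) cA) as (U & oU & Ux & h).
  - exists (fun _ => True). split; [apply open_full|]. tauto.
  - intros W W' (U & oU & Ux & h) (U' & oU' & Ux' & h').
    exists (fun z => U z /\ U' z). split; [apply open_inter; auto|]. split; [auto|].
    intros z [k|k] [k1 k2]; [apply (h z)|apply (h' z)]; auto.
  - intros W W' s (U & oU & Ux & h). exists U; auto.
  - intros [y Ay]. destruct (hX x y) as (U & V & oU & oV & Ux & Vy & d).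
    { intros ->; auto. }
    exists (fun z => V (proj1_sig z)). split; [apply incl_continuous; auto|].
    split; [auto|]. exists U. split; [auto|]. split; [auto|]. intros z k1 k2.
    apply (d (proj1_sig z)); auto.
  - exists U. split; [auto|]. split; [auto|]. intros y Uy Ay.
    apply (h (exist _ y Ay)); auto.
Qed.

Lemma closed_map {X Y : Top} (f : X -> Y) (A : X -> Prop) :
  compact X -> hausdorff Y -> continuous f -> closed A ->
  closed (fun y => exists x, A x /\ f x = y).
Proof.
  intros cX hY cf cA. apply compact_closed; auto.
  apply (@compact_image (subspace A) (subspace (fun y => exists x, A x /\ f x = y))
    (fun z => exist _ (f (proj1_sig z))
         (ex_intro _ (proj1_sig z) (conj (proj2_sig z) eq_refl)))).
  - apply continuous_into_sub. cbn. exact (continuous_comp _ _ (incl_continuous A) cf).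
  - intros [y (x & Ax & <-)]. exists (exist _ x Ax). apply sig_eq; auto.
  - apply compact_closed_sub; auto.
Qed.

(** * Real-valued functions *)

Lemma continuous_of_eps {X : Top} (f : X -> R_top) :
  (forall x eps, (0 < eps)%R -> exists U, isOpen U /\ U x /\
     forall y, U y -> (Rabs (f y - f x) < eps)%R) ->
  continuous f.
Proof.
  intros H V oV. apply open_local. intros x Vx.
  destruct (oV _ Vx) as (eps & pos & h). destruct (H x eps pos) as (U & oU & Ux & k).
  exists U. auto.
Qed.

Lemma R_continuous_of_lipschitz (f : R_top -> R_top) :
  (forall x y, (Rabs (f y - f x) <= Rabs (y - x))%R) -> continuous f.
Proof.
  intro H. apply continuous_of_eps. intros x eps pos.
  exists (fun y => (Rabs (y - x) < eps)%R). split; [|split].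
  - intros y hy. exists (eps - Rabs (y - x))%R. split; [lra|]. intros z hz.
    replace (z - x)%R with ((z - y) + (y - x))%R by ring.
    pose proof (Rabs_triang (z - y) (y - x)). lra.
  - rewrite Rminus_diag, Rabs_R0; auto.
  - intros y hy. specialize (H x y). lra.
Qed.

Lemma open_lt {X : Top} (f : X -> R_top) (a : R) :
  continuous f -> isOpen (fun x => (f x < a)%R).
Proof.
  intro cf. apply (cf (fun r : R_top => (r < a)%R)). intros r hr.
  exists (a - r)%R. split; [lra|]. intros y hy. apply Rabs_def2 in hy. lra.
Qed.

Lemma open_gt {X : Top} (f : X -> R_top) (a : R) :
  continuous f -> isOpen (fun x => (a < f x)%R).
Proof.
  intro cf. apply (cf (fun r : R_top => (a < r)%R)). intros r hr.
  exists (r - a)%R. split; [lra|]. intros y hy. apply Rabs_def2 in hy. lra.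
Qed.

(** * Urysohn functions on compact Hausdorff spaces *)

Section Urysohn.
Variable X : Top.
Hypotheses (cX : compact X) (hX : hausdorff X).

Definition well_inside (U V : X -> Prop) : Prop :=
  isOpen U /\ isOpen V /\ forall x, closure U x -> V x.

Lemma well_inside_interpolation U V : well_inside U V ->
  exists W, well_inside U W /\ well_inside W V.
Proof.
  intros (oU & oV & h).
  destruct (compact_hausdorff_normal (closure U) (fun x => ~ V x) cX hX)
    as (W & W' & oW & oW' & h1 & h2 & d).
  - apply closed_closure.
  - apply closed_compl; auto.
  - intros x [a b]; auto.
  - exists W. split; split; auto. split; [auto|]. intros x hx. apply NNPP; intro n.
    assert (c : ~ W' x); [|apply c; auto].
    apply (closure_min W (fun x => ~ W' x)); [apply closed_compl; auto| |auto].
    intros y Wy Wy'; apply (d y); auto.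
Qed.

(** Choosing by [epsilon] gives a function total in [U] and [V], so that [dyadic] can be defined by
    plain recursion. *)
Definition interp (U V : X -> Prop) : X -> Prop :=
  epsilon (inhabits U) (fun W => well_inside U W /\ well_inside W V).

Lemma interp_spec U V : well_inside U V ->
  well_inside U (interp U V) /\ well_inside (interp U V) V.
Proof. intro h. unfold interp. apply epsilon_spec, well_inside_interpolation; auto. Qed.

Variables U0 U1 : X -> Prop.
Hypothesis U01 : well_inside U0 U1.

(* [dyadic n k] plays the role of the open set of index k / 2^n. *)
Fixpoint dyadic (n k : nat) : X -> Prop :=
  match n with
  | O => match k with O => U0 | 1 => U1 | _ => fun _ => True end
  | S n => if Nat.even k then dyadic n (Nat.div2 k)
           else interp (dyadic n (Nat.div2 k)) (dyadic n (S (Nat.div2 k)))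
  end.

Lemma dyadic_double n k : dyadic (S n) (2 * k) = dyadic n k.
Proof.
  cbn [dyadic]. replace (Nat.even (2 * k)) with true by (symmetry; apply Nat.even_spec; exists k; auto).
  rewrite Nat.div2_double. reflexivity.
Qed.

Lemma dyadic_succ_double n k :
  dyadic (S n) (S (2 * k)) = interp (dyadic n k) (dyadic n (S k)).
Proof.
  cbn [dyadic]. replace (Nat.even (S (2 * k))) with false.
  - rewrite Nat.div2_succ_double. reflexivity.
  - rewrite Nat.even_succ. symmetry. rewrite Nat.odd_mul. reflexivity.
Qed.

Lemma dyadic_well_inside n : forall k, well_inside (dyadic n k) (dyadic n (S k)).
Proof.
  induction n as [|n IH]; intro k.
  - destruct U01 as (o0 & o1 & _). destruct k as [|[|k]]; cbn; auto;
      repeat split; auto; apply open_full.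
  - destruct (Nat.Even_or_Odd k) as [[j ->]|[j ->]].
    + rewrite dyadic_double, dyadic_succ_double. apply interp_spec, IH.
    + replace (2 * j + 1)%nat with (S (2 * j)) by lia.
      replace (S (S (2 * j))) with (2 * S j)%nat by lia.
      rewrite dyadic_double, dyadic_succ_double. apply interp_spec, IH.
Qed.

Lemma dyadic_mono n k j x : (k <= j)%nat -> dyadic n k x -> dyadic n j x.
Proof.
  induction 1; auto. intro h. apply (dyadic_well_inside n m), subset_closure; auto.
Qed.

Lemma dyadic_refine n m k : dyadic (m + n) (2 ^ m * k) = dyadic n k.
Proof.
  induction m as [|m IH]; [cbn; f_equal; lia|].
  cbn [Nat.add]. replace (2 ^ S m * k)%nat with (2 * (2 ^ m * k))%nat by (cbn; lia).
  rewrite dyadic_double. exact IH.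
Qed.

(** Both indices are rewritten over the common denominator 2^(n + n'), where [dyadic_mono] compares
    them. *)
Lemma dyadic_le n k n' k' x :
  (INR k / 2 ^ n <= INR k' / 2 ^ n')%R -> dyadic n k x -> dyadic n' k' x.
Proof.
  intros h Hx. rewrite <- (dyadic_refine n n') in Hx. rewrite <- (dyadic_refine n' n).
  rewrite Nat.add_comm in Hx. revert Hx. apply dyadic_mono.
  apply INR_le. rewrite !mult_INR, !pow_INR.
  replace (INR 2) with 2%R by (cbn; lra).
  assert (0 < 2 ^ n)%R by (apply pow_lt; lra). assert (0 < 2 ^ n')%R by (apply pow_lt; lra).
  apply Rmult_le_compat_r with (r := (2 ^ n * 2 ^ n')%R) in h; [|nra].
  replace (INR k / 2 ^ n * (2 ^ n * 2 ^ n'))%R with (2 ^ n' * INR k)%R in h by (field; lra).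
  replace (INR k' / 2 ^ n' * (2 ^ n * 2 ^ n'))%R with (2 ^ n * INR k')%R in h by (field; lra).
  exact h.
Qed.

(** The level of [x] will be the supremum of the indices of dyadic sets missing [x]. The value 0
    keeps this set nonempty when [x] lies in all of them. *)
Definition lower_index (x : X) (r : R) : Prop :=
  r = 0%R \/ exists n k, r = (INR k / 2 ^ n)%R /\ ~ dyadic n k x.

Lemma lower_index_bound n k x r :
  dyadic n k x -> lower_index x r -> (r <= INR k / 2 ^ n)%R.
Proof.
  intros Hx [->|(m & j & -> & nx)].
  - apply Rmult_le_pos; [apply pos_INR|]. left. apply Rinv_0_lt_compat, pow_lt; lra.
  - destruct (Rle_or_lt (INR j / 2 ^ m) (INR k / 2 ^ n)) as [h|h]; [exact h|].
    exfalso; apply nx. apply dyadic_le with n k; [lra|auto].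
Qed.

(** The index is 2 at every stage, and at stage 0 the set of index 2 is already the whole space.
    Hence levels are bounded. *)
Lemma dyadic_full n x : dyadic n (2 * 2 ^ n) x.
Proof.
  apply dyadic_le with 0%nat 2%nat; [|exact I].
  rewrite mult_INR, pow_INR. cbn [INR pow]. replace (1 + 1)%R with 2%R by lra.
  right. field. apply pow_nonzero; lra.
Qed.

Lemma lower_index_lub x : exists m, is_lub (lower_index x) m.
Proof.
  destruct (completeness (lower_index x)) as [m Hm].
  - exists (INR (2 * 2 ^ 0) / 2 ^ 0)%R. intros r. apply lower_index_bound, dyadic_full.
  - exists 0%R. left; auto.
  - exists m; auto.
Qed.

Definition level (x : X) : R := proj1_sig (constructive_indefinite_description _ (lower_index_lub x)).

Lemma level_lub x : is_lub (lower_index x) (level x).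
Proof. unfold level. apply proj2_sig. Qed.

Lemma level_le n k x : dyadic n k x -> (level x <= INR k / 2 ^ n)%R.
Proof. intro h. apply (level_lub x). intros r. apply lower_index_bound; auto. Qed.

Lemma level_ge n k x : ~ dyadic n k x -> (INR k / 2 ^ n <= level x)%R.
Proof. intro h. apply (level_lub x). right; exists n, k; auto. Qed.

Lemma level_ge0 x : (0 <= level x)%R.
Proof. apply (level_lub x). left; auto. Qed.

Lemma dyadic_first n x : exists k, dyadic n k x /\ forall j, (j < k)%nat -> ~ dyadic n j x.
Proof.
  destruct (dec_inh_nat_subset_has_unique_least_element (fun k => dyadic n k x))
    as (k & [h1 h2] & _).
  - intro k; apply classic.
  - exists (2 * 2 ^ n)%nat. apply dyadic_full.
  - exists k. split; [auto|]. intros j hj hn. apply h2 in hn. lia.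
Qed.

(** Let [k] be the first index at stage [n] whose set contains [x]. The closure of the set of index
    k - 2 lies inside the set of index k - 1, which misses [x]; so removing that closure from the
    set of index [k] leaves a neighbourhood of [x]. On it the level stays between (k - 2) / 2^n and
    k / 2^n. *)
Lemma level_continuous : continuous (level : X -> R_top).
Proof.
  apply continuous_of_eps. intros x eps pos.
  assert (small : exists n, (2 / 2 ^ n < eps)%R).
  { destruct (pow_lt_1_zero (/ 2) ltac:(rewrite Rabs_right; lra) (eps / 2) ltac:(lra)) as [N HN].
    exists N. specialize (HN N (le_n _)). rewrite pow_inv in HN.
    rewrite Rabs_right in HN.
    - unfold Rdiv in *. lra.
    - left. apply Rinv_0_lt_compat, pow_lt; lra. }
  destruct small as [n Hn].
  assert (p2 : (0 < / 2 ^ n)%R) by (apply Rinv_0_lt_compat, pow_lt; lra).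
  destruct (dyadic_first n x) as (k & hk & lk).
  assert (V : exists V, isOpen V /\ V x /\
            forall y, V y -> ((INR k - 2) / 2 ^ n <= level y <= INR k / 2 ^ n)%R).
  { assert (ok : isOpen (dyadic n k)) by apply (dyadic_well_inside n k).
    (* For [k] equal to 0 or 1 the lower bound is not positive, and nothing has to be removed. *)
    destruct k as [|[|k]].
    1, 2: eexists; split; [exact ok|]; split; [exact hk|]; intros y hy;
      (split; [|apply level_le; auto]); pose proof (level_ge0 y); cbn [INR]; unfold Rdiv; nra.
    exists (fun y => dyadic n (S (S k)) y /\ ~ closure (dyadic n k) y). split; [|split].
    - apply open_inter; [exact ok|]. apply closed_closure.
    - split; [auto|]. intro h. apply (lk (S k)); [lia|]. apply (dyadic_well_inside n k); auto.
    - intros y [h1 h2]. split; [|apply level_le; auto].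
      replace (INR (S (S k)) - 2)%R with (INR k) by (rewrite !S_INR; lra).
      apply level_ge. intro h; apply h2, subset_closure; auto. }
  destruct V as (V & oV & Vx & hV). exists V. split; [auto|]. split; [auto|].
  intros y Vy. pose proof (hV x Vx) as hx. pose proof (hV y Vy) as hy.
  assert (lx : ((INR k - 1) / 2 ^ n <= level x)%R).
  { destruct k as [|k].
    - pose proof (level_ge0 x). cbn [INR]. unfold Rdiv. nra.
    - replace (INR (S k) - 1)%R with (INR k) by (rewrite S_INR; lra).
      apply level_ge, lk. lia. }
  unfold Rdiv in *. apply Rabs_def1; nra.
Qed.

End Urysohn.

Lemma compact_hausdorff_tychonoff (X : Top) : compact X -> hausdorff X -> tychonoff X.
Proof.
  intros cX hX. split; [auto|]. intros A x cA nA.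
  destruct (compact_hausdorff_point_separation A x cX hX cA nA)
    as (U & V & oU & oV & Ux & h & d).
  assert (W : well_inside X U (fun y => ~ A y)).
  { split; [auto|]. split; [exact cA|]. intros y hy Ay.
    assert (c : ~ V y); [|apply c; auto].
    apply (closure_min U (fun x => ~ V x)); [apply closed_compl; auto| |auto].
    intros z Uz Vz; apply (d z); auto. }
  set (f := level X cX hX U (fun y => ~ A y) W).
  (* Levels range up to 2, so they are cut off at 1. *)
  exists (fun y => Rmin (f y) 1 : R_top). split; [|split; [|split]].
  - apply (continuous_comp _ (fun r : R_top => Rmin r 1 : R_top) (level_continuous X cX hX _ _ W)).
    apply R_continuous_of_lipschitz. intros a b. unfold Rmin.
    destruct (Rle_dec a 1), (Rle_dec b 1); unfold Rabs; repeat destruct Rcase_abs; lra.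
  - assert (hx := level_le X cX hX _ _ W 0 0 x Ux). cbn in hx.
    pose proof (level_ge0 X cX hX _ _ W x). fold f in hx, H. rewrite Rmin_left; lra.
  - intros y Ay. assert (hy := level_ge X cX hX _ _ W 0 1 y (fun k => k Ay)). cbn in hy.
    fold f in hy. rewrite Rmin_right; lra.
  - intro y. pose proof (level_ge0 X cX hX _ _ W y). fold f in H. split.
    + apply Rmin_glb; lra.
    + apply Rmin_r.
Qed.

(** * The unit interval as a compact Hausdorff target for real functions *)

Definition unit_interval : Top := subspace (fun r : R_top => (0 <= r <= 1)%R).

Lemma unit_interval_hausdorff : hausdorff unit_interval.
Proof.
  apply (hausdorff_embedding (incl (fun r : R_top => (0 <= r <= 1)%R))); [apply incl_embedding|].
  intros x y n. set (d := (Rabs (y - x) / 2)%R).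
  assert (dp : (0 < d)%R).
  { unfold d. assert (0 < Rabs (y - x))%R by (apply Rabs_pos_lt; intro; apply n; cbn in *; lra). lra. }
  exists (fun z => (Rabs (z - x) < d)%R), (fun z => (Rabs (z - y) < d)%R).
  assert (o : forall a : R, R_open (fun z => (Rabs (z - a) < d)%R)).
  { intros a z hz. exists (d - Rabs (z - a))%R. split; [lra|]. intros w hw.
    replace (w - a)%R with ((w - z) + (z - a))%R by ring.
    pose proof (Rabs_triang (w - z) (z - a)). lra. }
  split; [apply o|]. split; [apply o|]. rewrite !Rminus_diag, !Rabs_R0.
  split; [auto|]. split; [auto|]. intros z [h1 h2].
  pose proof (Rabs_triang (y - z) (z - x)) as t.
  replace (y - z + (z - x))%R with (y - x)%R in t by ring.
  rewrite (Rabs_minus_sym y z) in t. unfold d in *. lra.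
Qed.

Lemma unit_interval_compact : compact unit_interval.
Proof.
  apply compact_of_ind. intros J J0 JU JS Jl.
  (* The supremum [m] of the [t] with [0, t] in the ideal has a neighbourhood in the ideal, which
     pushes past [m] unless 1 has been reached. *)
  set (E := fun t : R => (0 <= t <= 1)%R /\ J (fun z : unit_interval => (proj1_sig z <= t)%R)).
  assert (E0 : E 0%R).
  { assert (h0 : (0 <= 0 <= 1)%R) by lra. split; [lra|].
    destruct (Jl (exist _ 0%R h0)) as (U & _ & U0 & hU).
    eapply JS; [|exact hU]. intros z hz.
    assert (ez : z = exist _ 0%R h0) by (apply sig_eq; pose proof (proj2_sig z); cbn in *; lra).
    rewrite ez; auto. }
  destruct (completeness E) as [m [ub lub]].
  { exists 1%R. intros t [h _]; lra. }
  { exists 0%R; auto. }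
  assert (hm : (0 <= m <= 1)%R).
  { split; [apply ub; auto|]. apply lub. intros t [h _]; lra. }
  destruct (Jl (exist _ m hm)) as (U & oU & Um & hU).
  destruct (oU _ Um) as (V & oV & Vm & hV). destruct (oV _ Vm) as (eps & pos & hball).
  cbn in hball.
  assert (t : exists t, E t /\ (m - eps < t)%R).
  { apply NNPP; intro n. enough (m <= m - eps)%R by lra. apply lub. intros t Et.
    destruct (Rle_or_lt t (m - eps)); auto. exfalso; apply n; exists t; auto. }
  destruct t as (t & [ht Jt] & hmt).
  assert (J2 : J (fun z : unit_interval => (proj1_sig z < m + eps)%R)).
  { eapply JS; [|exact (JU _ _ Jt hU)]. intros z hz. cbn.
    destruct (Rle_or_lt (proj1_sig z) t) as [h|h]; [left; auto|right].
    apply hV, hball. apply Rabs_def1; lra. }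
  destruct (Rle_or_lt (m + eps / 2) 1) as [h|h].
  - exfalso. enough (m + eps / 2 <= m)%R by lra. apply ub. split; [lra|].
    eapply JS; [|exact J2]. intros z hz; cbn in *; lra.
  - eapply JS; [|exact J2]. intros z _. pose proof (proj2_sig z). cbn in *. lra.
Qed.

(** * Collapsing a closed set to a point *)

Section Collapse.
Variables (B : Top) (A : B -> Prop) (a0 : B).

(** Classes are encoded by representatives: the points off [A], and [a0] for the whole of [A]. The
    topology put on them below is the quotient topology of [collapse_map]. *)
Definition collapse_pt : Type := {p : B | ~ A p \/ p = a0}.

Definition collapse_map (p : B) : collapse_pt :=
  match excluded_middle_informative (A p) with
  | left _ => exist _ a0 (or_intror eq_refl)
  | right n => exist _ p (or_introl n)
  end.

Definition collapse : Top.
Proof.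
  refine (@mkTop collapse_pt (fun V => isOpen (fun p => V (collapse_map p))) _ _ _).
  - apply open_full.
  - intros U V hU hV. exact (open_inter B _ _ hU hV).
  - intros F h. apply open_local. intros p (U & FU & Up).
    exists (fun q => U (collapse_map q)). split; [apply h; auto|]. split; [auto|].
    intros q hq; exists U; auto.
Defined.

Hypothesis Aa0 : A a0.

Lemma collapse_map_continuous : continuous (collapse_map : B -> collapse).
Proof. intros V oV; exact oV. Qed.

Lemma collapse_map_surj (t : collapse) : exists p, collapse_map p = t.
Proof.
  destruct t as [p hp]. exists p. unfold collapse_map.
  destruct (excluded_middle_informative (A p)) as [h|h]; apply sig_eq; cbn; auto.
  destruct hp; congruence.
Qed.

Lemma collapse_map_eq p p' :
  collapse_map p = collapse_map p' <-> p = p' \/ (A p /\ A p').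
Proof.
  unfold collapse_map.
  destruct (excluded_middle_informative (A p)), (excluded_middle_informative (A p'));
    split; intro h.
  - auto.
  - apply sig_eq; auto.
  - apply (f_equal (@proj1_sig _ _)) in h; cbn in h. subst p'. tauto.
  - exfalso. destruct h as [e|[]]; [rewrite e in *|]; tauto.
  - apply (f_equal (@proj1_sig _ _)) in h; cbn in h. subst p. tauto.
  - exfalso. destruct h as [e|[]]; [rewrite e in *|]; tauto.
  - left. apply (f_equal (@proj1_sig _ _)) in h; auto.
  - apply sig_eq; cbn. destruct h as [h|[]]; tauto.
Qed.

Hypotheses (cB : compact B) (hB : hausdorff B) (cA : closed A).

Lemma collapse_compact : compact collapse.
Proof. exact (compact_image _ collapse_map_continuous collapse_map_surj cB). Qed.

Lemma collapse_saturated_open (O : B -> Prop) :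
  isOpen O -> (forall p p', A p -> A p' -> O p -> O p') ->
  exists V : collapse -> Prop, isOpen V /\ forall p, V (collapse_map p) <-> O p.
Proof.
  intros oO sat. exists (fun t : collapse => O (proj1_sig t)).
  assert (h : forall p, O (proj1_sig (collapse_map p)) <-> O p).
  { intro p. unfold collapse_map. destruct (excluded_middle_informative (A p)); cbn; [|tauto].
    split; apply sat; auto. }
  split; [|exact h]. cbn. eapply open_ext; [exact oO|]. intro p. rewrite h. tauto.
Qed.

Lemma collapse_hausdorff : hausdorff collapse.
Proof.
  (* Of two different classes at least one is a point off [A], so up to symmetry [p'] is such a
     point. Either [p] represents [A] and a closed set is separated from a point, or both lie off
     [A] and their neighbourhoods are cut down to miss it; each way the open sets are saturated. *)
  assert (key : forall p p', p <> p' -> ~ A p' -> exists U V : collapse -> Prop,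
    isOpen U /\ isOpen V /\ U (collapse_map p) /\ V (collapse_map p') /\ forall z, ~ (U z /\ V z)).
  { intros p p' n nA'.
    assert (s : exists O O', isOpen O /\ isOpen O' /\ O p /\ O' p' /\ (forall z, ~ (O z /\ O' z))
      /\ (forall q q', A q -> A q' -> O q -> O q') /\ (forall q q', A q -> A q' -> O' q -> O' q')).
    { destruct (classic (A p)) as [Ap|nA].
      - destruct (compact_hausdorff_point_separation A p' cB hB cA nA')
          as (U & V & oU & oV & Up & h & d).
        exists V, U. split; [auto|]. split; [auto|]. split; [auto|]. split; [auto|].
        split; [intros z []; apply (d z); auto|]. split; [auto|].
        intros q q' Aq _ Uq. exfalso. apply (d q); auto.
      - destruct (hB p p' n) as (U & V & oU & oV & Up & Vp & d).
        exists (fun z => U z /\ ~ A z), (fun z => V z /\ ~ A z).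
        split; [apply open_inter; auto|]. split; [apply open_inter; auto|].
        split; [auto|]. split; [auto|]. split; [|tauto].
        intro z; specialize (d z); tauto. }
    destruct s as (O & O' & oO & oO' & Op & Op' & d & s & s').
    destruct (collapse_saturated_open O oO s) as (U & oU & hU).
    destruct (collapse_saturated_open O' oO' s') as (V & oV & hV).
    exists U, V. split; [auto|]. split; [auto|]. split; [apply hU; auto|]. split; [apply hV; auto|].
    intros z [h1 h2]. destruct (collapse_map_surj z) as [q <-]. apply (d q).
    split; [apply hU; auto|apply hV; auto]. }
  intros t t' n. destruct (collapse_map_surj t) as [p <-], (collapse_map_surj t') as [p' <-].
  rewrite collapse_map_eq in n. destruct (classic (A p')) as [h|h].
  - destruct (key p' p) as (U & V & oU & oV & Up & Vp & d); [intros ->; tauto|tauto|].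
    exists V, U. split; [auto|]. split; [auto|]. split; [auto|]. split; [auto|].
    intros z []; apply (d z); auto.
  - apply key; auto.
Qed.

End Collapse.

(** * Permanence of compactness-like properties *)

Definition closed_embedding {X Y : Top} (f : X -> Y) : Prop :=
  embedding f /\ closed (image f).

Lemma closed_embedding_image {X Y : Top} (f : X -> Y) (A : X -> Prop) :
  closed_embedding f -> closed A -> closed (fun y => exists x, A x /\ f x = y).
Proof.
  intros [(cf & jf & of) ci] cA. destruct (of _ cA) as (V & oV & hV).
  eapply open_ext; [exact (open_or _ _ ci oV)|]. intro y; cbn. split.
  - intros [h|h] (x & Ax & <-); [apply h; exists x; auto|apply hV in h; auto].
  - intro h. destruct (classic (image f y)) as [[x <-]|n]; [right|left; auto].
    apply hV. intro Ax; apply h; exists x; auto.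
Qed.

Lemma id_closed_embedding (X : Top) : closed_embedding (fun x : X => x).
Proof.
  split; [apply id_embedding|]. apply closed_ext with (fun _ => True).
  - apply closed_ext with (fun x => ~ False); [apply closed_compl, open_empty|tauto].
  - intro x; split; [exists x; auto|auto].
Qed.

(** Through this lemma the invariance of P under homeomorphisms comes from its invariance under
    perfect maps. *)
Lemma perfect_of_embedding {X Y : Top} (f : X -> Y) :
  embedding f -> (forall y, exists x, f x = y) -> perfect_surj f.
Proof.
  intros ef sf. split; [apply ef|]. split; [auto|]. split.
  - intros A cA. apply closed_embedding_image; [|auto]. split; [auto|].
    apply closed_ext with (fun _ => ~ False); [apply closed_compl, open_empty|].
    intro y; split; [intros _; apply sf|tauto].
  - intro y. destruct (sf y) as [x hx].
    apply compact_at_most_two with (a := exist _ x hx) (b := exist _ x hx).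
    intros [z hz]. left. apply sig_eq; cbn. apply ef. congruence.
Qed.

(** * Disjoint sums *)

Definition sum_top (X Y : Top) : Top.
Proof.
  refine (@mkTop (X + Y) (fun U => isOpen (fun x => U (inl x)) /\ isOpen (fun y => U (inr y))) _ _ _).
  - split; apply open_full.
  - intros U V [a b] [c d]. split; [exact (open_inter X _ _ a c)|exact (open_inter Y _ _ b d)].
  - intros F h. split; apply open_local.
    + intros x (U & FU & Ux). exists (fun x => U (inl x)). split; [apply h; auto|].
      split; [auto|]. intros; exists U; auto.
    + intros x (U & FU & Ux). exists (fun x => U (inr x)). split; [apply h; auto|].
      split; [auto|]. intros; exists U; auto.
Defined.

Definition copair {X Y Z : Top} (f : X -> Z) (g : Y -> Z) (s : sum_top X Y) : Z :=
  match s with inl x => f x | inr y => g y end.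

Lemma copair_continuous {X Y Z : Top} (f : X -> Z) (g : Y -> Z) :
  continuous f -> continuous g -> continuous (copair f g).
Proof. intros cf cg V oV. split; [apply cf|apply cg]; auto. Qed.

Lemma inl_embedding (X Y : Top) : embedding (inl : X -> sum_top X Y).
Proof.
  split; [intros V oV; apply oV|]. split; [congruence|]. intros U oU.
  exists (fun s : sum_top X Y => match s with inl x => U x | inr _ => False end).
  split; [split; [exact oU|apply open_empty]|tauto].
Qed.

Lemma inr_embedding (X Y : Top) : embedding (inr : Y -> sum_top X Y).
Proof.
  split; [intros V oV; apply oV|]. split; [congruence|]. intros U oU.
  exists (fun s : sum_top X Y => match s with inl x => False | inr y => U y end).
  split; [split; [apply open_empty|exact oU]|tauto].
Qed.

Lemma tychonoff_sum (X Y : Top) : tychonoff X -> tychonoff Y -> tychonoff (sum_top X Y).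
Proof.
  intros [hX rX] [hY rY]. split.
  - intros [x|y] [x'|y'] n.
    + destruct (hX x x') as (U & V & oU & oV & Ux & Vx & d); [congruence|].
      exists (fun s => match s with inl x => U x | inr _ => False end),
        (fun s => match s with inl x => V x | inr _ => False end).
      split; [split; [auto|apply open_empty]|]. split; [split; [auto|apply open_empty]|].
      split; [auto|]. split; [auto|]. intros [z|z]; [apply d|tauto].
    + exists (fun s => match s with inl x => True | inr _ => False end),
        (fun s => match s with inl x => False | inr _ => True end).
      split; [split; [apply open_full|apply open_empty]|].
      split; [split; [apply open_empty|apply open_full]|].
      split; [auto|]. split; [auto|]. intros [z|z]; tauto.
    + exists (fun s => match s with inl x => False | inr _ => True end),
        (fun s => match s with inl x => True | inr _ => False end).
      split; [split; [apply open_empty|apply open_full]|].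
      split; [split; [apply open_full|apply open_empty]|].
      split; [auto|]. split; [auto|]. intros [z|z]; tauto.
    + destruct (hY y y') as (U & V & oU & oV & Ux & Vx & d); [congruence|].
      exists (fun s => match s with inr x => U x | inl _ => False end),
        (fun s => match s with inr x => V x | inl _ => False end).
      split; [split; [apply open_empty|auto]|]. split; [split; [apply open_empty|auto]|].
      split; [auto|]. split; [auto|]. intros [z|z]; [tauto|apply d].
  - assert (c1 : forall Z : Top, continuous (fun _ : Z => 1%R : R_top)).
    { intros Z V _. apply open_local. intros z h. exists (fun _ => True).
      split; [apply open_full|auto]. }
    intros A [x|y] [cl cr] nA.
    + destruct (rX (fun x => A (inl x)) x cl nA) as (f & cf & f0 & f1 & f01).
      exists (copair f (fun _ => 1%R : R_top)).
      split; [apply copair_continuous; auto|]. split; [auto|].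
      split; intros [z|z]; cbn; auto; intros; lra.
    + destruct (rY (fun x => A (inr x)) y cr nA) as (f & cf & f0 & f1 & f01).
      exists (copair (fun _ => 1%R : R_top) f).
      split; [apply copair_continuous; auto|]. split; [auto|].
      split; intros [z|z]; cbn; auto; intros; lra.
Qed.

(** A closed set has as image a union of two closed sets, and a fibre takes at most one point from
    each summand. This transfers P between a disjoint sum and a union of overlapping closed
    pieces. *)
Lemma copair_perfect {X Y Z : Top} (f : X -> Z) (g : Y -> Z) :
  closed_embedding f -> closed_embedding g -> (forall z, image f z \/ image g z) ->
  perfect_surj (copair f g).
Proof.
  intros hf hg cov. split; [apply copair_continuous; [apply hf|apply hg]|]. split; [|split].
  - intro z. destruct (cov z) as [[x h]|[y h]]; [exists (inl x)|exists (inr y)]; auto.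
  - intros A [cl cr].
    eapply closed_ext;
      [exact (closed_or _ _ (closed_embedding_image f _ hf cl) (closed_embedding_image g _ hg cr))|].
    intro z; split.
    + intros [(x & Ax & h)|(y & Ay & h)]; [exists (inl x)|exists (inr y)]; auto.
    + intros ([x|y] & As & h); [left; exists x|right; exists y]; auto.
  - assert (jf : forall x x', f x = f x' -> x = x') by apply hf.
    assert (jg : forall x x', g x = g x' -> x = x') by apply hg.
    intro z. destruct (classic (image f z)) as [[x hx]|nf].
    + destruct (classic (image g z)) as [[y hy]|ng].
      * apply compact_at_most_two with (a := exist _ (inl x) hx) (b := exist _ (inr y) hy).
        intros [[u|u] hu]; [left|right]; apply sig_eq; cbn in *; f_equal; [apply jf|apply jg]; congruence.
      * apply compact_at_most_two with (a := exist _ (inl x) hx) (b := exist _ (inl x) hx).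
        intros [[u|u] hu]; left; apply sig_eq; cbn in *.
        -- f_equal; apply jf; congruence.
        -- exfalso; apply ng; exists u; auto.
    + destruct (cov z) as [h|[y hy]]; [tauto|].
      apply compact_at_most_two with (a := exist _ (inr y) hy) (b := exist _ (inr y) hy).
      intros [[u|u] hu]; left; apply sig_eq; cbn in *.
      * exfalso; apply nf; exists u; auto.
      * f_equal; apply jg; congruence.
Qed.

Section CompactnessLike.
Variable P : Top -> Prop.
Hypothesis HP : compactness_like P.

Lemma P_perfect {X Y : Top} (f : X -> Y) :
  tychonoff X -> tychonoff Y -> perfect_surj f -> (P X <-> P Y).
Proof. apply HP. Qed.

Lemma P_embedding_onto {X Y : Top} (f : X -> Y) :
  tychonoff Y -> embedding f -> (forall y, exists x, f x = y) -> (P X <-> P Y).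
Proof.
  intros tY ef sf. apply (P_perfect f); auto.
  - eapply tychonoff_embedding; eauto.
  - apply perfect_of_embedding; auto.
Qed.

(** Finite additivity with zero pieces. *)
Lemma P_empty (X : Top) : (X -> False) -> P X.
Proof.
  intro h. destruct HP as (_ & add & _).
  apply (add X 0%nat (fun _ _ => False)).
  - split; [intro x; destruct (h x)|intros A x; destruct (h x)].
  - lia.
  - lia.
  - intro x; destruct (h x).
Qed.

Lemma corestrict_embedding {X Y : Top} (f : X -> Y) (A : Y -> Prop) (hA : forall x, A (f x)) :
  embedding f -> embedding (fun x => exist _ (f x) (hA x) : subspace A).
Proof.
  intros (cf & jf & of). split; [apply continuous_into_sub; exact cf|]. split.
  - intros x x' h. apply jf. exact (f_equal (@proj1_sig _ _) h).
  - intros U oU. destruct (of U oU) as (V & oV & hV).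
    exists (fun z => V (proj1_sig z)). split; [apply incl_continuous; auto|exact hV].
Qed.

(* The summand Y of Z + Y is clopen, and Z + Y maps perfectly onto Z. *)
Lemma P_closed_embedding {Y Z : Top} (f : Y -> Z) :
  tychonoff Z -> closed_embedding f -> P Z -> P Y.
Proof.
  intros tZ ef PZ. assert (tY : tychonoff Y) by (eapply tychonoff_embedding; [apply ef|auto]).
  assert (tS : tychonoff (sum_top Z Y)) by (apply tychonoff_sum; auto).
  assert (PS : P (sum_top Z Y)).
  { apply (P_perfect (copair (fun z : Z => z) f)); auto.
    apply copair_perfect; [apply id_closed_embedding|auto|]. intro z; left; exists z; auto. }
  set (A := fun s : sum_top Z Y => match s with inl _ => False | inr _ => True end).
  assert (PA : P (subspace A)).
  { destruct HP as (her & _). apply her; auto.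
    - split; [apply open_empty|apply open_full].
    - split; cbn; [apply open_ext with (fun _ => True); [apply open_full|tauto]|].
      apply open_ext with (fun _ => False); [apply open_empty|tauto]. }
  apply (P_embedding_onto (fun y : Y => exist A (inr y) I : subspace A)); auto.
  - apply tychonoff_sub; auto.
  - apply (corestrict_embedding (inr : Y -> sum_top Z Y) A (fun _ => I)), inr_embedding.
  - intros [[z|y] h]; [destruct h|]. exists y. apply sig_eq; auto.
Qed.

Lemma P_sum (X Y : Top) : tychonoff X -> tychonoff Y -> P X -> P Y -> P (sum_top X Y).
Proof.
  intros tX tY PX PY. assert (tS : tychonoff (sum_top X Y)) by (apply tychonoff_sum; auto).
  set (A := fun (i : nat) (s : sum_top X Y) =>
     match s with inl _ => i = 0%nat | inr _ => i = 1%nat end).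
  assert (cA : forall i, closed (A i)).
  { intro i. split; cbn; apply open_local; intros z h; exists (fun _ => True);
      (split; [apply open_full|auto]). }
  destruct HP as (_ & add & _). apply (add _ 2%nat A); auto.
  - intros i hi. split; [auto|]. destruct i as [|[|i]]; [| |lia].
    + apply (P_embedding_onto (fun x : X => exist (A 0%nat) (inl x) eq_refl : subspace (A 0%nat))); auto.
      * apply tychonoff_sub; auto.
      * apply (corestrict_embedding (inl : X -> sum_top X Y) (A 0%nat) (fun _ => eq_refl)), inl_embedding.
      * intros [[x|y] h]; [|discriminate h]. exists x. apply sig_eq; auto.
    + apply (P_embedding_onto (fun x : Y => exist (A 1%nat) (inr x) eq_refl : subspace (A 1%nat))); auto.
      * apply tychonoff_sub; auto.
      * apply (corestrict_embedding (inr : Y -> sum_top X Y) (A 1%nat) (fun _ => eq_refl)), inr_embedding.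
      * intros [[x|y] h]; [discriminate h|]. exists y. apply sig_eq; auto.
  - intros i j [x|y] _ _; cbn; congruence.
  - intros [x|y]; [exists 0%nat|exists 1%nat]; cbn; lia.
Qed.

Lemma sub_incl_closed_embedding {X : Top} (A C : X -> Prop) (h : forall x, A x -> C x) :
  closed A ->
  closed_embedding (fun z : subspace A => exist C (proj1_sig z) (h _ (proj2_sig z)) : subspace C).
Proof.
  intro cA. split; [apply (corestrict_embedding (incl A) C (fun z => h _ (proj2_sig z))), incl_embedding|].
  eapply closed_ext; [exact (continuous_closed _ _ (incl_continuous C) cA)|].
  intros [z hz]; split; cbn.
  - intro Az. exists (exist _ z Az). apply sig_eq; auto.
  - intros [[w Aw] e]. apply (f_equal (@proj1_sig _ _)) in e. cbn in e. subst; auto.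
Qed.

(** Finite additivity speaks of disjoint pieces; an overlapping union is the perfect image of the
    disjoint sum of its pieces. *)
Lemma P_union {X : Top} (A C : X -> Prop) :
  tychonoff X -> closed A -> closed C -> P (subspace A) -> P (subspace C) ->
  P (subspace (fun x => A x \/ C x)).
Proof.
  intros tX cA cC PA PC.
  assert (tA := tychonoff_sub A tX). assert (tC := tychonoff_sub C tX).
  assert (hA := sub_incl_closed_embedding A (fun x => A x \/ C x) (fun x h => or_introl h) cA).
  assert (hC := sub_incl_closed_embedding C (fun x => A x \/ C x) (fun x h => or_intror h) cC).
  apply (P_perfect (copair _ _) (tychonoff_sum _ _ tA tC) (tychonoff_sub _ tX) (copair_perfect _ _ hA hC
     ltac:(intros [z [Az|Cz]]; [left; exists (exist _ z Az)|right; exists (exist _ z Cz)]; apply sig_eq; auto))).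
  apply P_sum; auto.
Qed.

Lemma P_closed_subset {X : Top} (A C : X -> Prop) :
  tychonoff X -> closed A -> (forall x, A x -> C x) -> P (subspace C) -> P (subspace A).
Proof.
  intros tX cA h. apply (P_closed_embedding _ (tychonoff_sub C tX) (sub_incl_closed_embedding A C h cA)).
Qed.

End CompactnessLike.

(** Since [N] is saturated, the image of D ∩ N is the image of D intersected with that of N, so
    closedness survives the restriction even when [N] is not closed; and the fibres are full fibres
    of [phi], closed in [B] and hence compact. *)
Lemma perfect_restriction {B T : Top} (phi : B -> T) (N : B -> Prop) :
  compact B -> hausdorff T -> continuous phi ->
  (forall p p', N p -> phi p = phi p' -> N p') ->
  perfect_surj (fun z : subspace N =>
    exist (fun t => exists p, N p /\ phi p = t) (phi (proj1_sig z))
      (ex_intro _ (proj1_sig z) (conj (proj2_sig z) eq_refl)) :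
    subspace (fun t => exists p, N p /\ phi p = t)).
Proof.
  intros cB hT cphi sat. split; [|split; [|split]].
  - apply continuous_into_sub. cbn. exact (continuous_comp _ _ (incl_continuous N) cphi).
  - intros [t (p & Np & <-)]. exists (exist _ p Np). apply sig_eq; auto.
  - intros A cA. destruct (sub_closed_trace _ _ cA) as (D & cD & hD).
    eapply closed_ext;
      [exact (continuous_closed _ _ (incl_continuous _) (closed_map phi D cB hT cphi cD))|].
    intros [t ht]; cbn. split.
    + intros (p & Dp & e). destruct ht as (p' & Np' & e').
      assert (Np : N p) by (apply (sat p'); congruence).
      exists (exist _ p Np). split; [apply hD; auto|]. apply sig_eq; auto.
    + intros (z & Az & e). exists (proj1_sig z). split; [apply hD; auto|].
      exact (f_equal (@proj1_sig _ _) e).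
  - intros [t (p0 & Np0 & e0)].
    assert (cF : compact (subspace (fun p => phi p = t))).
    { apply compact_closed_sub; auto.
      exact (continuous_closed phi (fun s => s = t) cphi (point_closed t hT)). }
    assert (NF : forall z : subspace (fun p => phi p = t), N (proj1_sig z)).
    { intros [p hp]. apply (sat p0); cbn; congruence. }
    unshelve eapply (compact_image _ _ _ cF).
    + intro z. exists (exist _ (proj1_sig z) (NF z)). apply sig_eq. exact (proj2_sig z).
    + apply continuous_into_sub, continuous_into_sub. cbn. exact (incl_continuous _).
    + intros [[p Np] hp]. exists (exist _ p (f_equal (@proj1_sig _ _) hp)).
      apply sig_eq, sig_eq; auto.
Qed.

(** * Limits in an extension along the Stone-Čech compactification *)

Lemma dense_nbhd {X B : Top} (e : X -> B) (W : B -> Prop) (p : B) :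
  dense (image e) -> isOpen W -> W p -> exists x, W (e x).
Proof.
  intros d oW Wp. destruct (proj1 (closure_nbhd _ p) (d p) W oW Wp) as (q & Wq & x & <-).
  exists x; auto.
Qed.

(* Equivalently, the map B -> beta E extending the identity of X sends p to y; this form
   needs no compactification of E. *)
Definition lim {X B : Top} (e : X -> B) (E : Ext X) (p : B) (y : ext_sp E) : Prop :=
  forall V, isOpen V -> V y ->
    exists W, isOpen W /\ W p /\ forall x, W (e x) -> V (ext_emb E x).

Section Limits.
Variables (X B : Top) (e : X -> B).
Hypothesis SC : is_stone_cech e.

Lemma sc_dense : dense (image e).
Proof. apply SC. Qed.

Lemma sc_extend (f : X -> R_top) :
  continuous f -> (forall x, (0 <= f x <= 1)%R) ->
  exists F : B -> R_top, continuous F /\ forall x, F (e x) = f x.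
Proof.
  intros cf f01. destruct SC as (_ & _ & _ & _ & uni).
  destruct (uni unit_interval (fun x => exist _ (f x) (f01 x)))
    as (g & cg & hg).
  - apply unit_interval_compact.
  - apply unit_interval_hausdorff.
  - apply continuous_into_sub. exact cf.
  - exists (fun p => proj1_sig (g p) : R_top). split.
    + exact (continuous_comp _ _ cg (incl_continuous _)).
    + intro x. rewrite hg. reflexivity.
Qed.

Section One.
Variable E : Ext X.
Hypothesis HE : is_extension E.

Lemma ext_separate (y : ext_sp E) (V : ext_sp E -> Prop) :
  isOpen V -> V y -> exists f : ext_sp E -> R_top, continuous f /\ f y = 0%R /\
    (forall z, ~ V z -> f z = 1%R) /\ forall z, (0 <= f z <= 1)%R.
Proof.
  intros oV Vy. destruct HE as ([_ r] & _). apply (r (fun z => ~ V z)).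
  - apply closed_compl; auto.
  - tauto.
Qed.

Lemma lim_emb x : lim e E (e x) (ext_emb E x).
Proof.
  intros V oV Vx. destruct HE as (_ & (ci & _) & _). destruct SC as (_ & _ & (_ & _ & oe) & _).
  destruct (oe _ (ci V oV)) as (W & oW & hW). exists W. split; [auto|].
  split; [apply hW; auto|]. intros; apply hW; auto.
Qed.

Lemma lim_meets p y V W :
  lim e E p y -> isOpen V -> V y -> isOpen W -> W p ->
  exists x, W (e x) /\ V (ext_emb E x).
Proof.
  intros l oV Vy oW Wp. destruct (l V oV Vy) as (W' & oW' & Wp' & h).
  destruct (dense_nbhd e (fun q => W q /\ W' q) p) as (x & a & b); auto using sc_dense, open_inter.
  exists x; auto.
Qed.

Lemma lim_unique p y y' : lim e E p y -> lim e E p y' -> y = y'.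
Proof.
  intros l l'. apply NNPP; intro n. destruct HE as ([hY _] & _).
  destruct (hY y y' n) as (U & V & oU & oV & Uy & Vy & d).
  destruct (l U oU Uy) as (W & oW & Wp & h).
  destruct (lim_meets p y' V W) as (x & a & b); auto. apply (d (ext_emb E x)); auto.
Qed.

(** [X] has the same topology inside [B] and inside [E], so a neighbourhood of [e x] that is
    separated from [p] yields one of [ext_emb E x] that a limit along [p] would have to meet. *)
Lemma lim_at_emb p x : lim e E p (ext_emb E x) -> p = e x.
Proof.
  intro l. apply NNPP; intro n. destruct SC as (_ & hB & (ce & _) & _).
  destruct (hB p (e x) n) as (U & V & oU & oV & Up & Vx & d).
  destruct HE as (_ & (_ & _ & oi) & _). destruct (oi _ (ce V oV)) as (V' & oV' & hV').
  destruct (lim_meets p _ V' U l) as (z & a & b); auto; [apply hV'; auto|].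
  apply hV' in b. apply (d (e z)); auto.
Qed.

Lemma lim_off_X p y : ~ image e p -> lim e E p y -> ~ image (ext_emb E) y.
Proof. intros n l [x <-]. apply n. exists x. symmetry. apply lim_at_emb; auto. Qed.

(** Limits taken near [p] are only known to lie in the closure of the set where [f] is below 1/2;
    the function [f] leaves the room to keep this closure inside [V]. *)
Lemma lim_continuous p y V : lim e E p y -> isOpen V -> V y ->
  exists W, isOpen W /\ W p /\ forall p' y', W p' -> lim e E p' y' -> V y'.
Proof.
  intros l oV Vy. destruct (ext_separate y V oV Vy) as (f & cf & f0 & f1 & _).
  destruct (l (fun z => (f z < 1 / 2)%R)) as (W & oW & Wp & h).
  - apply open_lt; auto.
  - rewrite f0; lra.
  - exists W. split; [auto|]. split; [auto|]. intros p' y' Wp' l'. apply NNPP; intro n.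
    destruct (lim_meets p' y' (fun z => (1 / 2 < f z)%R) W) as (x & a & b); auto.
    + apply open_gt; auto.
    + rewrite f1; auto; lra.
    + apply h in a. lra.
Qed.

(** Here the Stone-Čech property turns adherence into convergence: a function separating [y] from
    the complement of [V] extends from [X] to [B], so near [p] its values settle around one number,
    and adherence forces that number to be small. *)
Lemma lim_of_adherence p y :
  (forall V W, isOpen V -> V y -> isOpen W -> W p -> exists x, W (e x) /\ V (ext_emb E x)) ->
  lim e E p y.
Proof.
  intros H V oV Vy. destruct (ext_separate y V oV Vy) as (f & cf & f0 & f1 & f01).
  destruct (sc_extend (fun x => f (ext_emb E x))) as (F & cF & hF).
  - exact (continuous_comp _ _ (proj1 (proj1 (proj2 HE))) cf).
  - auto.
  - assert (Fp : (F p < 1 / 2)%R).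
    { apply Rnot_le_lt; intro n.
      destruct (H (fun z => (f z < 1 / 4)%R) (fun q => (1 / 4 < F q)%R)) as (x & a & b).
      - apply open_lt; auto.
      - rewrite f0; lra.
      - apply open_gt; auto.
      - lra.
      - rewrite hF in a. lra. }
    exists (fun q => (F q < 1 / 2)%R). split; [apply open_lt; auto|]. split; [auto|].
    intros x hx. rewrite hF in hx. apply NNPP; intro n. rewrite f1 in hx; auto. lra.
Qed.

Lemma not_lim_separate p y : ~ lim e E p y ->
  exists V W, isOpen V /\ V y /\ isOpen W /\ W p /\ forall x, W (e x) -> ~ V (ext_emb E x).
Proof.
  intro n. apply NNPP; intro m. apply n, lim_of_adherence. intros V W oV Vy oW Wp.
  apply NNPP; intro k. apply m. exists V, W. split; [auto|]. split; [auto|].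
  split; [auto|]. split; [auto|]. intros x a b. apply k; exists x; auto.
Qed.

(** The limit map is closed: if no point of [A] converged to [y], each would be separated from [y]
    by [not_lim_separate], and compactness of [B] would leave one neighbourhood of [y] free of
    limits of points of [A]. *)
Lemma lim_closed (A : B -> Prop) y : closed A ->
  (forall V, isOpen V -> V y -> exists p y', A p /\ V y' /\ lim e E p y') ->
  exists p, A p /\ lim e E p y.
Proof.
  intros cA H. apply NNPP; intro n.
  destruct (compact_ind (fun W => exists V, isOpen V /\ V y /\
     forall p y', W p -> A p -> V y' -> ~ lim e E p y') (proj1 SC)) as (V & oV & Vy & h).
  - exists (fun _ => True). split; [apply open_full|]. tauto.
  - intros W W' (V & oV & Vy & h) (V' & oV' & Vy' & h').
    exists (fun z => V z /\ V' z). split; [apply open_inter; auto|]. split; [auto|].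
    intros p y' [k|k] Ap [v v']; [apply h|apply h']; auto.
  - intros W W' s (V & oV & Vy & h). exists V. split; [auto|]. split; [auto|].
    intros p y' Wp; apply h; auto.
  - intro p. destruct (classic (A p)) as [Ap|nA].
    + destruct (not_lim_separate p y) as (V & W & oV & Vy & oW & Wp & h).
      { intro l; apply n; exists p; auto. }
      exists W. split; [auto|]. split; [auto|]. exists V. split; [auto|]. split; [auto|].
      intros p' y' Wp' _ Vy' l. destruct (lim_meets p' y' V W) as (x & a & b); auto.
      apply (h x); auto.
    + exists (fun q => ~ A q). split; [exact cA|]. split; [auto|].
      exists (fun _ => True). split; [apply open_full|]. tauto.
  - destruct (H V oV Vy) as (p & y' & Ap & Vy' & l). apply (h p y'); auto.
Qed.

Lemma lim_surjective y : exists p, lim e E p y.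
Proof.
  destruct (lim_closed (fun _ => ~ False) y) as (p & _ & l).
  - apply closed_compl, open_empty.
  - intros V oV Vy. destruct HE as (_ & _ & d). destruct (dense_nbhd _ V y d oV Vy) as [x Vx].
    exists (e x), (ext_emb E x). split; [tauto|]. split; [auto|]. apply lim_emb.
  - exists p; auto.
Qed.

(** [not_lim_separate] for all points of the remainder at once, by compactness of the remainder. *)
Lemma no_limit_separate p : compact (remainder E) -> (forall y, ~ lim e E p y) ->
  exists V W, isOpen V /\ isOpen W /\ W p /\ (forall y, ~ image (ext_emb E) y -> V y) /\
    forall x, W (e x) -> ~ V (ext_emb E x).
Proof.
  intros cR n.
  destruct (compact_ind (fun Q : remainder E -> Prop => exists V W, isOpen V /\ isOpen W /\ W p /\
     (forall z, Q z -> V (proj1_sig z)) /\ forall x, W (e x) -> ~ V (ext_emb E x)) cR)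
    as (V & W & oV & oW & Wp & h1 & h2).
  - exists (fun _ => False), (fun _ => True). split; [apply open_empty|].
    split; [apply open_full|]. tauto.
  - intros Q Q' (V & W & oV & oW & Wp & h1 & h2) (V' & W' & oV' & oW' & Wp' & h1' & h2').
    exists (fun z => V z \/ V' z), (fun q => W q /\ W' q).
    split; [apply open_or; auto|]. split; [apply open_inter; auto|]. split; [auto|].
    split; [intros z []; auto|]. intros x [a b] [c|c]; [apply (h2 x)|apply (h2' x)]; auto.
  - intros Q Q' s (V & W & oV & oW & Wp & h1 & h2). exists V, W. auto 10.
  - intros [y Ry]. destruct (not_lim_separate p y (n y)) as (V & W & oV & Vy & oW & Wp & h).
    exists (fun z => V (proj1_sig z)). split; [apply incl_continuous; auto|]. split; [auto|].
    exists V, W. auto 10.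
  - exists V, W. split; [auto|]. split; [auto|]. split; [auto|]. split; [|auto].
    intros y Ry. apply (h1 (exist _ y Ry)). auto.
Qed.

(** This set is the K of the overview. A point off [X] that has a limit has it in the remainder, so
    the separation of [p] from the whole remainder excludes such points near [p]. *)
Lemma limit_domain_closed : compact (remainder E) -> isOpen (image e) ->
  closed (fun p => ~ image e p /\ exists y, lim e E p y).
Proof.
  intros cR oX. apply open_local. intros p hp.
  destruct (classic (image e p)) as [Xp|nX].
  - exists (image e). split; [auto|]. split; [auto|]. tauto.
  - destruct (no_limit_separate p cR) as (V & W & oV & oW & Wp & h1 & h2).
    { intros y l. apply hp; split; [auto|]. exists y; auto. }
    exists W. split; [auto|]. split; [auto|]. intros q Wq (nq & y & l).
    destruct (lim_meets q y V W) as (x & a & b); auto.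
    + apply h1. eapply lim_off_X; eauto.
    + apply (h2 x); auto.
Qed.

End One.

(** The condition says that each limit fibre of [E2] is contained in one of [E1]; it combines the
    inclusion of domains with the refinement of partitions. *)
Lemma ext_le_lim (E1 E2 : Ext X) : is_extension E1 -> is_extension E2 ->
  (ext_le E1 E2 <->
   forall y2, exists y1, forall p, lim e E2 p y2 -> lim e E1 p y1).
Proof.
  intros H1 H2. split.
  - intros (g & cg & hg) y2. exists (g y2). intros p l V oV Vy.
    destruct (l _ (cg V oV) Vy) as (W & oW & Wp & h). exists W. split; [auto|].
    split; [auto|]. intros x Wx. rewrite <- hg. auto.
  - intro H.
    set (g := fun y2 => proj1_sig (constructive_indefinite_description _ (H y2))).
    assert (hg : forall y2 p, lim e E2 p y2 -> lim e E1 p (g y2)).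
    { intro y2. unfold g. apply proj2_sig. }
    exists g. split.
    + intros V oV. apply open_local. intros y2 Vy. apply NNPP; intro n.
      (* If [g] is not continuous at [y2], then [lim_closed] finds a point in the closure of [S]
         that converges to [y2] in [E2]. Its limit in [E1] is [g y2], which lies in [V], so by
         [lim_continuous] a neighbourhood of the point misses [S]. *)
      set (S := fun p => exists y1, lim e E1 p y1 /\ ~ V y1).
      destruct (lim_closed E2 H2 (closure S) y2) as (p & Sp & l).
      * apply closed_closure.
      * intros V2 oV2 V2y.
        assert (k : exists y', V2 y' /\ ~ V (g y')).
        { apply NNPP; intro m. apply n. exists V2. split; [auto|]. split; [auto|].
          intros y' Vy'. apply NNPP; intro m'. apply m; exists y'; auto. }
        destruct k as (y' & Vy' & nV). destruct (lim_surjective E2 H2 y') as [p l].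
        exists p, y'. split; [|auto]. apply subset_closure. exists (g y'). auto.
      * destruct (lim_continuous E1 H1 p (g y2) V) as (W & oW & Wp & h); auto.
        destruct (proj1 (closure_nbhd S p) Sp W oW Wp) as (q & Wq & y1 & l1 & nV).
        apply nV. eapply h; eauto.
    + intro x. apply (lim_unique E1 H1 (e x)); [apply hg|]; apply lim_emb; auto.
Qed.

(** The closure of [U] in [X] is compact, hence closed in [B]; by density it contains every open set
    of [B] whose trace is [U]. *)
Lemma image_open : locally_compact X -> isOpen (image e).
Proof.
  intro lc. destruct SC as (cB & hB & (ce & je & oe) & d & _). apply open_local.
  intros p [x <-]. destruct (lc x) as (U & oU & Ux & cU).
  destruct (oe U oU) as (V & oV & hV). exists V. split; [auto|]. split; [apply hV; auto|].
  set (K := fun q => exists x, closure U x /\ e x = q).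
  assert (cK : closed K).
  { apply compact_closed; auto.
    apply (@compact_image (subspace (closure U)) (subspace K)
      (fun z => exist K (e (proj1_sig z)) (ex_intro _ (proj1_sig z) (conj (proj2_sig z) eq_refl)))); auto.
    - apply continuous_into_sub. cbn. exact (continuous_comp _ _ (incl_continuous _) ce).
    - intros [q (z & hz & <-)]. exists (exist _ z hz). apply sig_eq; auto. }
  intros q Vq. enough (Kq : K q) by (destruct Kq as (z & _ & <-); exists z; auto).
  apply NNPP; intro n.
  destruct (dense_nbhd e (fun r => V r /\ ~ K r) q d (open_inter B _ _ oV cK)) as (z & a & b); auto.
  apply b. exists z. split; [apply subset_closure, hV|]; auto.
Qed.

End Limits.

(** * Extensions obtained from quotients of the Stone-Čech compactification *)

Section Lambda.
Variables (P : Top -> Prop) (X B : Top) (e : X -> B).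
Hypothesis HP : compactness_like P.
Hypothesis tX : tychonoff X.
Hypothesis SC : is_stone_cech e.

(** * The set lambda_P X inside the Stone-Čech compactification *)

Lemma lambda_open : isOpen (lambdaP P e).
Proof.
  apply open_local. intros p (C & cC & PC & U & oU & Up & h).
  exists U. split; [auto|]. split; [auto|]. intros q Uq. exists C. split; [auto|].
  split; [auto|]. exists U; auto.
Qed.

Lemma trace_subset_closure (C : X -> Prop) (W : B -> Prop) :
  isOpen W -> (forall x, W (e x) -> C x) ->
  forall p, W p -> interior (closure (fun q => exists x, C x /\ e x = q)) p.
Proof.
  intros oW h p Wp. exists W. split; [auto|]. split; [auto|]. intros q Wq.
  apply closure_nbhd. intros V oV Vq.
  destruct (dense_nbhd e (fun r => V r /\ W r) q (sc_dense X B e SC) (open_inter B _ _ oV oW))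
    as (x & a & b); auto.
  exists (e x). split; [auto|]. exists x; auto.
Qed.

Lemma closure_trace (C : X -> Prop) x :
  closure (fun q => exists z, C z /\ e z = q) (e x) -> closure C x.
Proof.
  intro h. apply closure_nbhd. intros U oU Ux.
  destruct SC as (_ & _ & (_ & _ & oe) & _). destruct (oe U oU) as (V & oV & hV).
  destruct (proj1 (closure_nbhd _ (e x)) h V oV) as (q & Vq & z & Cz & <-); [apply hV; auto|].
  exists z. split; [apply hV|]; auto.
Qed.

Lemma cozero_below {Y : Top} (f : Y -> R_top) :
  (* The witness is the truncation of [f] at 1/2, shifted so as to vanish exactly where [f] is at
     least 1/2. *)
  continuous f -> cozero (fun y => (f y < 1 / 2)%R).
Proof.
  intro cf. exists (fun y => Rmin (f y) (1 / 2) - 1 / 2 : R_top)%R. split.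
  - apply (continuous_comp _ (fun r : R_top => Rmin r (1 / 2) - 1 / 2 : R_top)%R cf).
    apply R_continuous_of_lipschitz. intros a b. unfold Rmin.
    destruct (Rle_dec a (1 / 2)), (Rle_dec b (1 / 2)); unfold Rabs; repeat destruct Rcase_abs; lra.
  - intro y. unfold Rmin. destruct (Rle_dec (f y) (1 / 2)); split; intro; lra.
Qed.

Lemma closure_below {Y : Top} (f : Y -> R_top) y :
  continuous f -> closure (fun y => (f y < 1 / 2)%R) y -> (f y <= 1 / 2)%R.
Proof.
  intros cf h. apply (closure_min (fun y => (f y < 1 / 2)%R) (fun y => (f y <= 1 / 2)%R)); auto.
  - apply closed_ext with (fun y => ~ (1 / 2 < f y)%R).
    + apply closed_compl, open_gt; auto.
    + intro z; split; intro; lra.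
  - intros; lra.
Qed.

Lemma X_in_lambda : locally_P P X -> forall x, lambdaP P e (e x).
Proof.
  intros lP x. destruct (lP x) as (U & oU & Ux & PU). destruct tX as [_ rX].
  destruct (rX (fun z => ~ U z) x) as (f & cf & f0 & f1 & f01); [apply closed_compl; auto|tauto|].
  exists (fun z => (f z < 1 / 2)%R). split; [apply cozero_below; auto|]. split.
  - apply (P_closed_subset P HP _ (closure U)); auto; [apply closed_closure|].
    intros z hz. apply (closure_below f z cf) in hz. apply subset_closure.
    apply NNPP; intro n. rewrite f1 in hz; auto. lra.
  - destruct SC as (_ & _ & (_ & _ & oe) & _).
    destruct (oe (fun z => (f z < 1 / 2)%R)) as (V & oV & hV); [apply open_lt; auto|].
    apply (trace_subset_closure _ V); auto; [intros; apply hV; auto|].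
    apply hV. rewrite f0. lra.
Qed.

(** The compact set [G] is covered by finitely many of the interiors that make up lambda_P X. On [X]
    each of them lies in the closure of its cozero-set, and the finite union of these closures has
    P. *)
Lemma P_inside_lambda (A : X -> Prop) (G : B -> Prop) :
  closed A -> closed G -> (forall p, G p -> lambdaP P e p) -> (forall x, A x -> G (e x)) ->
  P (subspace A).
Proof.
  intros cA cG Gl AG.
  destruct (compact_ind (fun W : B -> Prop => exists D : X -> Prop, closed D /\ P (subspace D) /\
     forall x, W (e x) -> G (e x) -> D x) (proj1 SC)) as (D & cD & PD & h).
  - exists (fun _ => False). split; [|split].
    + apply closed_ext with (fun _ => ~ True); [apply closed_compl, open_full|tauto].
    + apply P_empty; auto. intros [z []].
    + tauto.
  - intros W W' (D & cD & PD & h) (D' & cD' & PD' & h').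
    exists (fun x => D x \/ D' x). split; [apply closed_or; auto|]. split.
    + apply P_union; auto.
    + intros x [a|a] g; auto.
  - intros W W' s (D & cD & PD & h). exists D; auto.
  - intro p. destruct (classic (G p)) as [Gp|nG].
    + destruct (Gl p Gp) as (C & _ & PC & U & oU & Up & h). exists U. split; [auto|].
      split; [auto|]. exists (closure C). split; [apply closed_closure|]. split; [auto|].
      intros x Ux _. apply closure_trace; auto.
    + exists (fun q => ~ G q). split; [exact cG|]. split; [auto|].
      exists (fun _ => False). split; [|split].
      * apply closed_ext with (fun _ => ~ True); [apply closed_compl, open_full|tauto].
      * apply P_empty; auto. intros [z []].
      * tauto.
  - apply (P_closed_subset P HP A D); auto.
Qed.

Lemma lambda_proper : ~ P X -> exists m, ~ lambdaP P e m.
Proof.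
  intro nP. apply NNPP; intro n. apply nP.
  assert (c : forall Y : Top, closed (fun _ : Y => True)).
  { intro Y. apply closed_ext with (fun _ => ~ False); [apply closed_compl, open_empty|tauto]. }
  apply (P_embedding_onto P HP (incl (fun _ : X => True)) tX (incl_embedding _)).
  - intro x. exists (exist _ x I). auto.
  - apply P_inside_lambda with (fun _ => True); auto. intros p _. apply NNPP; intro m.
    apply n; exists p; auto.
Qed.

(** This puts M inside K. A point without a limit has a cozero-set [C] near it whose closure in [X]
    avoids a neighbourhood of the remainder. That closure is then closed in [E] as well and inherits
    P from [E], so [p] is in lambda_P X. *)
Lemma EP_limits (E : Ext X) p : in_EP P E -> ~ lambdaP P e p -> exists y, lim e E p y.
Proof.
  intros (HE & PE & cR) nl. apply NNPP; intro n. apply nl.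
  destruct (no_limit_separate X B e SC E HE p cR) as (V & W & oV & oW & Wp & h1 & h2).
  { intros y l. apply n; exists y; auto. }
  destruct SC as (cB & hB & (ce & _) & _).
  destruct (compact_hausdorff_tychonoff B cB hB) as [_ rB].
  destruct (rB (fun q => ~ W q) p) as (F & cF & F0 & F1 & _); [apply closed_compl; auto|tauto|].
  assert (cFe : continuous (fun x => F (e x))) by (apply continuous_comp; auto).
  set (C := fun x => (F (e x) < 1 / 2)%R).
  assert (CW : forall x, closure C x -> W (e x)).
  { intros x hx. apply (closure_below (fun x => F (e x)) x cFe) in hx.
    apply NNPP; intro m. rewrite F1 in hx; auto. lra. }
  exists C. split; [apply (cozero_below (fun x => F (e x)) cFe)|]. split.
  - destruct HE as (tE & ei & _).
    apply (P_closed_embedding P HP (fun z : subspace (closure C) => ext_emb E (proj1_sig z))); auto.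
    split; [apply (embedding_comp (incl (closure C)) (ext_emb E)); auto; apply incl_embedding|].
    (* A point of [X] outside the image is handled by closedness in [X], a point of the remainder by
       its neighbourhood [V]. *)
    apply open_local. intros y ny. destruct (classic (image (ext_emb E) y)) as [[x <-]|nX].
    + destruct ei as (ci & ji & oi). destruct (oi _ (closed_closure C)) as (O & oO & hO).
      exists O. split; [auto|]. split.
      * apply hO. intro Cx. apply ny. exists (exist _ x Cx). auto.
      * intros y' Oy' [[z Cz] <-]. cbn in Oy'. apply hO in Oy'. auto.
    + exists V. split; [auto|]. split; [auto|]. intros y' Vy' [[z Cz] <-].
      apply (h2 z); auto.
  - apply (trace_subset_closure C (fun q => (F q < 1 / 2)%R)); auto; [apply open_lt; auto|].
    rewrite F0; lra.
Qed.

(** * Extensions as images of saturated subsets of B *)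

Definition quotient_ext {T : Top} (phi : B -> T) (N : B -> Prop) (HN : forall x, N (e x)) : Ext X :=
  @mkExt X (subspace (fun t => exists p, N p /\ phi p = t))
    (fun x => exist _ (phi (e x)) (ex_intro _ (e x) (conj (HN x) eq_refl))).

(** [N] stands for X ∪ K. The whole of [B] is mapped, so that the target is compact Hausdorff and
    its subspaces are Tychonoff; [adm_inj] leaves the points of [X] unglued, and [adm_saturated]
    makes the restriction of [phi] to [N] perfect. *)
Record admissible {T : Top} (phi : B -> T) (N : B -> Prop) : Prop := {
  adm_compact : compact T;
  adm_hausdorff : hausdorff T;
  adm_continuous : continuous phi;
  adm_inj : forall p x, phi p = phi (e x) -> p = e x;
  adm_closed : closed (fun p => N p /\ ~ image e p);
  adm_lambda : forall p, ~ lambdaP P e p -> N p;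
  adm_saturated : forall p p', N p -> phi p = phi p' -> N p'
}.

Section Model.
Variables (T : Top) (phi : B -> T) (N : B -> Prop) (HN : forall x, N (e x)).
Hypothesis adm : admissible phi N.

Lemma quotient_is_extension : is_extension (quotient_ext phi N HN).
Proof.
  destruct SC as (cB & hB & (ce & je & oe) & d & _). destruct adm as [cT hT cphi inj _ _ sat].
  split; [|split].
  - apply tychonoff_sub, compact_hausdorff_tychonoff; auto.
  - apply (corestrict_embedding (fun x => phi (e x))). split; [|split].
    + apply continuous_comp; auto.
    + intros x x' h. apply je, inj; auto.
    + intros U oU. destruct (oe U oU) as (V & oV & hV).
      (* The image of the complement of [V] is closed, and by [adm_inj] it contains no image of a
         point of [X] that lies in [V]. *)
      exists (fun t => ~ exists p, ~ V p /\ phi p = t). split.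
      * apply (closed_map phi); auto. apply closed_compl; auto.
      * intro x. rewrite hV. split.
        -- intros Vx (p & nV & h). apply inj in h. congruence.
        -- intro h. apply NNPP; intro nV. apply h. exists (e x); auto.
  - intros [t (p & Np & <-)]. apply closure_nbhd. intros U oU Ut.
    destruct (sub_open_trace _ _ oU) as (V & oV & hV). apply hV in Ut. cbn in Ut.
    destruct (dense_nbhd e (fun q => V (phi q)) p d (cphi V oV) Ut) as (x & Vx).
    exists (ext_emb (quotient_ext phi N HN) x). split; [apply hV; exact Vx|exists x; auto].
Qed.

Lemma quotient_lim p (s : ext_sp (quotient_ext phi N HN)) :
  lim e (quotient_ext phi N HN) p s <-> phi p = proj1_sig s.
Proof.
  destruct adm as [cT hT cphi inj _ _ sat]. split.
  - intro l. apply NNPP; intro n.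
    destruct (hT _ _ n) as (U & V & oU & oV & Up & Vs & d).
    destruct (lim_meets X B e SC _ p s (fun z => V (proj1_sig z)) (fun q => U (phi q)) l)
      as (x & a & b); auto.
    + apply incl_continuous; auto.
    + apply (d (phi (e x))); auto.
  - intros h V oV Vs. destruct (sub_open_trace _ _ oV) as (W & oW & hW).
    exists (fun q => W (phi q)). split; [apply cphi; auto|]. split.
    + rewrite h. apply hW; auto.
    + intros x Wx. apply hW. exact Wx.
Qed.

Lemma quotient_remainder_compact : compact (remainder (quotient_ext phi N HN)).
Proof.
  destruct SC as (cB & hB & (ce & je & oe) & d & _). destruct adm as [cT hT cphi inj cK _ sat].
  assert (cc := compact_closed_sub _ cB cK).
  unshelve eapply (@compact_image _ _ _ _ _ cc).
  - intros [p [Np nX]]. unshelve eexists; [exists (phi p), p; auto|].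
    intros [x h]. apply nX. exists x. apply (f_equal (@proj1_sig _ _)) in h. cbn in h.
    symmetry. apply inj; auto.
  - apply continuous_into_sub, continuous_into_sub.
    assert (c := continuous_comp _ _ (incl_continuous (fun p => N p /\ ~ image e p)) cphi).
    intros V oV. eapply open_ext; [exact (c V oV)|]. intros [p [Np nX]]. cbn. tauto.
  - intros [[t (p & Np & <-)] nX]. unshelve eexists; [exists p; split; auto|].
    + intros [x <-]. apply nX. exists x. apply sig_eq; auto.
    + apply sig_eq, sig_eq; auto.
Qed.

(** The left side does not mention [phi], so P passes between any two admissible quotients of the
    same [N]. *)
Lemma quotient_P_transfer : P (subspace N) <-> P (ext_sp (quotient_ext phi N HN)).
Proof.
  destruct SC as (cB & hB & (ce & je & oe) & d & _). destruct adm as [cT hT cphi inj cK _ sat].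
  apply (P_perfect P HP _ (tychonoff_sub N (compact_hausdorff_tychonoff B cB hB))
    (tychonoff_sub _ (compact_hausdorff_tychonoff T cT hT))
    (perfect_restriction phi N cB hT cphi sat)).
Qed.

Hypothesis lP : locally_P P X.

(* Condition (W) at the point onto which the whole remainder is collapsed. *)
Lemma quotient_P_of_single_fiber m :
  N m -> ~ image e m -> (forall p, N p -> ~ image e p -> phi p = phi m) ->
  P (ext_sp (quotient_ext phi N HN)).
Proof.
  intros Nm Xm single.
  destruct quotient_is_extension as (tE & ei & _).
  destruct HP as (_ & _ & _ & W).
  set (Z := ext_sp (quotient_ext phi N HN)).
  set (pm := exist _ (phi m) (ex_intro _ m (conj Nm eq_refl)) : Z).
  apply (W Z pm (fun U => isOpen U /\ U pm)); auto.
  - intros U oU Up. exists U; auto.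
  - intros U [oU Um]. destruct (sub_open_trace _ _ oU) as (V & oV & hV).
    set (A := fun x : X => ~ U (ext_emb (quotient_ext phi N HN) x)).
    assert (cA : closed A).
    { apply closed_compl. exact (proj1 ei U oU). }
    assert (PA : P (subspace A)).
    (* Outside the preimage of [V] everything is in lambda_P X: a point off lambda_P X belongs to
       the remainder part of [N], hence is sent to [phi m], which lies in [V]. *)
    { apply P_inside_lambda with (fun p => ~ V (phi p)).
      - auto.
      - apply closed_compl. apply (adm_continuous _ _ adm); auto.
      - intros p nV. apply NNPP; intro nl. apply nV.
        assert (Np := adm_lambda _ _ adm p nl).
        destruct (classic (image e p)) as [[x <-]|nX].
        + exfalso. apply nl, X_in_lambda; auto.
        + rewrite (single p); auto. apply (hV pm); auto.
      - intros x nU h. apply nU, hV. exact h. }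
    assert (h : forall z : subspace A, ~ U (ext_emb (quotient_ext phi N HN) (incl A z))).
    { intros [z hz]; exact hz. }
    apply (P_embedding_onto P HP
      (fun z : subspace A => exist _ (ext_emb (quotient_ext phi N HN) (incl A z)) (h z) : subspace (fun z => ~ U z)));
      auto.
    + apply tychonoff_sub; auto.
    + apply (corestrict_embedding (fun z : subspace A => ext_emb (quotient_ext phi N HN) (incl A z))).
      apply (embedding_comp (incl A)); auto. apply incl_embedding.
    + intros [[t (p & Np & <-)] nU]. destruct (classic (image e p)) as [[x <-]|nX].
      * assert (Ax : A x).
        { intro k. apply nU. apply hV. apply hV in k. exact k. }
        exists (exist _ x Ax). apply sig_eq, sig_eq. reflexivity.
      * exfalso. apply nU. apply hV. cbn. rewrite (single p); auto. apply (hV pm); auto.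
Qed.
End Model.

Lemma quotient_in_EP {T : Top} (phi : B -> T) (N : B -> Prop) (HN : forall x, N (e x)) :
  locally_P P X -> ~ P X -> admissible phi N -> in_EP P (quotient_ext phi N HN).
Proof.
  intros lP nP adm. split; [apply quotient_is_extension; auto|].
  split; [|apply quotient_remainder_compact; auto].
  apply quotient_P_transfer; auto.
  destruct (lambda_proper nP) as [m nl].
  destruct SC as (cB & hB & _).
  assert (Nm := adm_lambda _ _ adm m nl).
  assert (Xm : ~ image e m).
  { intros [x <-]. apply nl, X_in_lambda; auto. }
  set (K := fun p => N p /\ ~ image e p).
  assert (cK : closed K) by apply (adm_closed _ _ adm).
  assert (Km : K m) by (split; auto).
  (* Collapsing all of [K] gives a second admissible quotient of the same [N]. It has P by
     [quotient_P_of_single_fiber], and [quotient_P_transfer] leads from it through [N] to the given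
     one. *)
  assert (adm' : admissible (collapse_map B K m : B -> collapse B K m) N).
  { split; auto.
    - apply collapse_compact; auto.
    - apply collapse_hausdorff; auto.
    - apply collapse_map_continuous.
    - intros p x h. apply collapse_map_eq in h; auto. destruct h as [h|[_ [_ h]]]; auto.
      exfalso; apply h; exists x; auto.
    - apply (adm_lambda _ _ adm).
    - intros p p' Np h. apply collapse_map_eq in h; auto. destruct h as [<-|[_ [h _]]]; auto. }
  apply (quotient_P_transfer _ _ N HN adm').
  apply (quotient_P_of_single_fiber _ _ N HN adm' lP m); auto.
  intros p Np nX. apply collapse_map_eq; auto. right; split; [split|]; auto.
Qed.

End Lambda.

(** * The order of extensions determines the points of the lambda-remainder *)

Lemma ext_le_refl {X : Top} (E : Ext X) : ext_le E E.
Proof. exists (fun y => y). split; [apply id_continuous|auto]. Qed.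

Lemma ext_le_trans {X : Top} (E1 E2 E3 : Ext X) :
  ext_le E1 E2 -> ext_le E2 E3 -> ext_le E1 E3.
Proof.
  intros (g & cg & hg) (h & ch & hh). exists (fun y => g (h y)).
  split; [apply continuous_comp; auto|]. intro x. rewrite hh; auto.
Qed.

Lemma ext_equiv_le {X : Top} (E1 E2 : Ext X) :
  ext_equiv E1 E2 -> ext_le E1 E2 /\ ext_le E2 E1.
Proof.
  intros (h & k & ch & ck & kh & hk & hx). split; [exists k|exists h]; split; auto.
  intro x. rewrite <- hx. auto.
Qed.

Definition is_top (P : Top -> Prop) {X : Top} (E : Ext X) : Prop :=
  in_EP P E /\ forall A, in_EP P A -> ext_le A E.

(* The existence of b singles out the coatoms that add one point to the remainder among
   those that identify two points of it. *)
Definition adding_coatom (P : Top -> Prop) {X : Top} (c : Ext X) : Prop :=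
  in_EP P c /\ ~ is_top P c /\
  exists b, in_EP P b /\ ext_le b c /\ ~ ext_le c b /\
    forall a, in_EP P a -> ext_le b a ->
      ext_le a b \/ (ext_le a c /\ ext_le c a) \/ is_top P a.

Section Points.
Variables (P : Top -> Prop) (X B : Top) (e : X -> B).
Hypothesis HP : compactness_like P.
Hypothesis tX : tychonoff X.
Hypothesis lc : locally_compact X.
Hypothesis lP : locally_P P X.
Hypothesis nP : ~ P X.
Hypothesis SC : is_stone_cech e.

(** [core] is the M of the overview; [lambda_rest] and [core_add q] below are L and M + q. *)
Local Notation core := (fun p => ~ lambdaP P e p).

Definition with_X (K : B -> Prop) (p : B) : Prop := image e p \/ K p.

Lemma X_in_with_X K x : with_X K (e x).
Proof. left; exists x; auto. Qed.

Definition sub_ext (K : B -> Prop) : Ext X :=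
  quotient_ext X B e (fun p : B => p) (with_X K) (X_in_with_X K).

Definition pair_ext (K : B -> Prop) (a b : B) : Ext X :=
  quotient_ext X B e (collapse_map B (fun p => p = a \/ p = b) a : B -> collapse _ _ _)
    (with_X K) (X_in_with_X K).

Definition remainder_set (K : B -> Prop) : Prop :=
  closed K /\ (forall p, core p -> K p) /\ forall p, K p -> ~ image e p.

Lemma with_X_closed K : remainder_set K -> closed (fun p => with_X K p /\ ~ image e p).
Proof.
  intros (cK & _ & nX). eapply closed_ext; [exact cK|]. intro p. specialize (nX p).
  unfold with_X. tauto.
Qed.

Lemma sub_admissible K : remainder_set K -> admissible P X B e (fun p : B => p) (with_X K).
Proof.
  intro hK. destruct SC as (cB & hB & _). split; auto.
  - apply id_continuous.
  - apply with_X_closed; auto.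
  - intros p hp. right. apply hK; auto.
  - intros p p' h <-; auto.
Qed.

Lemma pair_admissible K a b : remainder_set K -> K a -> K b ->
  admissible P X B e (collapse_map B (fun p => p = a \/ p = b) a : B -> collapse _ _ _) (with_X K).
Proof.
  intros hK Ka Kb. destruct SC as (cB & hB & _).
  split.
  - apply collapse_compact; auto.
  - apply collapse_hausdorff; auto. apply closed_or; apply point_closed; auto.
  - apply collapse_map_continuous.
  - intros p x h. apply collapse_map_eq in h; auto. destruct h as [h|[_ h]]; auto.
    destruct hK as (_ & _ & nX). exfalso.
    destruct h as [h|h]; [apply (nX a)|apply (nX b)]; auto; exists x; auto.
  - apply with_X_closed; auto.
  - intros p hp. right. apply hK; auto.
  - intros p p' h hp. apply collapse_map_eq in hp; auto. destruct hp as [<-|[_ [->| ->]]]; auto;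
      right; auto.
Qed.

Lemma sub_in_EP K : remainder_set K -> in_EP P (sub_ext K).
Proof. intro hK. apply quotient_in_EP; auto. apply sub_admissible; auto. Qed.

Lemma pair_in_EP K a b : remainder_set K -> K a -> K b -> in_EP P (pair_ext K a b).
Proof. intros hK Ka Kb. apply quotient_in_EP; auto. apply pair_admissible; auto. Qed.

Lemma sub_lim K p s : remainder_set K -> (lim e (sub_ext K) p s <-> p = proj1_sig s).
Proof.
  intro hK. exact (quotient_lim P X B e SC _ _ _ (X_in_with_X K) (sub_admissible K hK) p s).
Qed.

Lemma pair_lim K a b p s : remainder_set K -> K a -> K b ->
  (lim e (pair_ext K a b) p s <-> collapse_map B (fun p => p = a \/ p = b) a p = proj1_sig s).
Proof.
  intros hK Ka Kb.
  exact (quotient_lim P X B e SC _ _ _ (X_in_with_X K) (pair_admissible K a b hK Ka Kb) p s).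
Qed.

Lemma EP_ext (E : Ext X) : in_EP P E -> is_extension E.
Proof. intros []; auto. Qed.

Lemma lim_on_with_X (E : Ext X) K p : in_EP P E ->
  (forall p, K p -> exists y, lim e E p y) -> with_X K p -> exists y, lim e E p y.
Proof.
  intros hE h [[x <-]|Kp]; [|auto]. exists (ext_emb E x). apply lim_emb; auto. apply hE.
Qed.

(** The limit fibres of [sub_ext K] are single points, so only the domains of the two limit maps are
    compared. *)
Lemma le_sub E K : in_EP P E -> remainder_set K ->
  (ext_le E (sub_ext K) <-> forall p, K p -> exists y, lim e E p y).
Proof.
  intros hE hK. rewrite (ext_le_lim X B e SC) by (apply EP_ext; auto using sub_in_EP). split.
  - intros h p Kp.
    destruct (h (exist _ p (ex_intro _ p (conj (or_intror Kp) eq_refl)))) as [y hy].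
    exists y. apply hy, sub_lim; auto.
  - intros h [t (p & Np & <-)]. destruct (lim_on_with_X E K p) as [y hy]; auto.
    exists y. intros p' hp'. apply sub_lim in hp'; auto. cbn in hp'. subst p'; auto.
Qed.

Lemma le_pair E K a b : in_EP P E -> remainder_set K -> K a -> K b ->
  (forall p, K p -> exists y, lim e E p y) -> (exists y, lim e E a y /\ lim e E b y) ->
  ext_le E (pair_ext K a b).
Proof.
  intros hE hK Ka Kb h (y0 & la & lb).
  apply (ext_le_lim X B e SC); try (apply EP_ext; auto using pair_in_EP).
  intros [t (p & Np & <-)]. destruct (lim_on_with_X E K p) as [y hy]; auto.
  exists y. intros p' hp'. apply pair_lim in hp'; auto. cbn in hp'.
  apply collapse_map_eq in hp'; auto. destruct hp' as [->|[h1 h2]]; auto.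
  assert (l0 : forall q, q = a \/ q = b -> lim e E q y0) by (intros q [->| ->]; auto).
  rewrite (lim_unique X B e SC E (EP_ext E hE) p y y0); auto.
Qed.

Lemma sub_le E K : in_EP P E -> remainder_set K ->
  (ext_le (sub_ext K) E <->
   (forall p y, lim e E p y -> with_X K p) /\
   (forall p p' y, lim e E p y -> lim e E p' y -> p = p')).
Proof.
  intros hE hK. rewrite (ext_le_lim X B e SC) by (apply EP_ext; auto using sub_in_EP). split.
  - intro h. split.
    + intros p y l. destruct (h y) as [[t (q & Nq & <-)] hs]. apply hs, sub_lim in l; auto.
      cbn in l. subst q; auto.
    + intros p p' y l l'. destruct (h y) as [s hs].
      apply hs, sub_lim in l; auto. apply hs, sub_lim in l'; auto. congruence.
  - intros [h1 h2] y. destruct (lim_surjective X B e SC E (EP_ext E hE) y) as [p l].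
    exists (exist _ p (ex_intro _ p (conj (h1 p y l) eq_refl))).
    intros p' l'. apply sub_lim; auto. cbn. eapply h2; eauto.
Qed.

Lemma pair_le E K a b : in_EP P E -> remainder_set K -> K a -> K b ->
  ext_le (pair_ext K a b) E ->
  (forall p y, lim e E p y -> with_X K p) /\
  (forall p p' y, lim e E p y -> lim e E p' y ->
     p = p' \/ ((p = a \/ p = b) /\ (p' = a \/ p' = b))).
Proof.
  intros hE hK Ka Kb.
  rewrite (ext_le_lim X B e SC) by (apply EP_ext; auto using pair_in_EP).
  intro h. split.
  - intros p y l. destruct (h y) as [[t (q & Nq & <-)] hs]. apply hs, pair_lim in l; auto.
    apply (adm_saturated _ _ _ _ _ _ (pair_admissible K a b hK Ka Kb) q p); auto.
  - intros p p' y l l'. destruct (h y) as [s hs].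
    apply hs, pair_lim in l; auto. apply hs, pair_lim in l'; auto.
    rewrite <- l' in l. apply collapse_map_eq in l; auto.
Qed.

(** * The largest extension and the coatoms that add a point *)

Definition lambda_rest (q : B) : Prop := lambdaP P e q /\ ~ image e q.

Definition core_add (q p : B) : Prop := core p \/ p = q.

Lemma core_off_X p : core p -> ~ image e p.
Proof. intros n [x <-]. apply n, X_in_lambda; auto. Qed.

Lemma core_remainder_set : remainder_set core.
Proof.
  split; [apply closed_compl, lambda_open|]. split; [auto|]. apply core_off_X.
Qed.

Lemma core_add_remainder_set q : lambda_rest q -> remainder_set (core_add q).
Proof.
  intros [_ nX]. split; [|split].
  - apply closed_or; [apply core_remainder_set|]. exact (point_closed q (proj1 (proj2 SC))).
  - intros p h; left; auto.
  - intros p [h| ->]; auto. apply core_off_X; auto.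
Qed.

Lemma EP_lim_core E : in_EP P E -> forall p, core p -> exists y, lim e E p y.
Proof. intros hE p n. apply (EP_limits P X B e HP SC E p hE n). Qed.

Lemma core_is_top : is_top P (sub_ext core).
Proof.
  split; [apply sub_in_EP, core_remainder_set|]. intros A hA.
  apply le_sub; auto using core_remainder_set. apply EP_lim_core; auto.
Qed.

Lemma is_top_iff E : in_EP P E -> (is_top P E <-> ext_le (sub_ext core) E).
Proof.
  intro hE. split; [intros [_ h]; apply h, core_is_top|].
  intro h. split; [auto|]. intros A hA. eapply ext_le_trans; [|exact h]. apply core_is_top; auto.
Qed.

Lemma core_add_not_top q : lambda_rest q -> ~ is_top P (sub_ext (core_add q)).
Proof.
  intros hq h. assert (rq := core_add_remainder_set q hq).
  apply is_top_iff in h; [|apply sub_in_EP; auto].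
  apply sub_le in h; auto using sub_in_EP, core_remainder_set.
  destruct h as [h _]. assert (K : core_add q q) by (right; auto).
  destruct (h q (exist _ q (ex_intro _ q (conj (or_intror K) eq_refl)))) as [n|n].
  - apply sub_lim; auto.
  - apply hq; auto.
  - apply n, hq.
Qed.

(** Every member of E_P(X) has limits on all of M, so [q] is the only point left to test. *)
Lemma le_core_add E q : in_EP P E -> lambda_rest q ->
  (ext_le E (sub_ext (core_add q)) <-> exists y, lim e E q y).
Proof.
  intros hE hq. rewrite le_sub by auto using core_add_remainder_set. split.
  - intro h; apply h; right; auto.
  - intros h p [n| ->]; auto. apply EP_lim_core; auto.
Qed.

Lemma core_add_adding_coatom q : lambda_rest q -> adding_coatom P (sub_ext (core_add q)).
Proof.
  intros hq. assert (rq := core_add_remainder_set q hq).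
  assert (Eq := sub_in_EP _ rq).
  split; [auto|]. split; [apply core_add_not_top; auto|].
  destruct (lambda_proper P X B e HP tX SC nP) as [m nm].
  assert (Kq : core_add q q) by (right; auto). assert (Km : core_add q m) by (left; auto).
  assert (Eb := pair_in_EP _ _ _ rq Kq Km).
  exists (pair_ext (core_add q) q m). split; [auto|]. split; [|split].
  - apply le_core_add; auto.
    exists (exist _ _ (ex_intro _ q (conj (or_intror Kq) eq_refl))). apply pair_lim; auto.
  - intro h. apply sub_le in h; auto. destruct h as [_ h].
    enough (q = m) by (subst; apply nm, hq).
    apply (h q m (exist _ _ (ex_intro _ q (conj (or_intror Kq) eq_refl)))); apply pair_lim; auto.
    cbn. apply collapse_map_eq; auto.
  - intros a Ea h. apply pair_le in h; auto. destruct h as [dom fib].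
    (* An extension above b can glue at most [q] with [m]. If it glues them it is below b; if [q]
       has a limit of its own it is equivalent to M + q; if [q] has no limit it is the top. *)
    destruct (classic (exists y, lim e a q y)) as [[y ly]|nq].
    + destruct (classic (lim e a m y)) as [lm|nlm].
      * left. apply le_pair; auto.
        -- intros p [n| ->]; [apply EP_lim_core; auto|exists y; auto].
        -- exists y; auto.
      * right; left. split; [apply le_core_add; auto; exists y; auto|].
        apply sub_le; auto. split; [auto|]. intros p p' z l l'.
        assert (uniq : forall z', lim e a q z' -> z' = y).
        { intros z' lz. apply (lim_unique X B e SC a (EP_ext a Ea) q); auto. }
        destruct (fib p p' z l l') as [->|[[->| ->] [->| ->]]]; auto;
          exfalso; apply nlm; [rewrite <- (uniq z l)|rewrite <- (uniq z l')]; auto.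
    + right; right. apply is_top_iff; auto. apply sub_le; auto using core_remainder_set.
      split.
      * intros p y l. destruct (dom p y l) as [h|[h| ->]]; [left; auto|right; auto|].
        exfalso; apply nq; exists y; auto.
      * intros p p' y l l'. destruct (fib p p' y l l') as [->|[[->| ->] [->| ->]]]; auto;
          exfalso; apply nq; exists y; auto.
Qed.

Lemma lim_in_core E p y : (forall q, lambda_rest q -> ~ exists y, lim e E q y) ->
  ~ image e p -> lim e E p y -> core p.
Proof. intros h nX l lp. apply (h p); [split; auto|]. exists y; auto. Qed.

Lemma core_pair_not_top a b : core a -> core b -> a <> b -> ~ is_top P (pair_ext core a b).
Proof.
  intros ca cb n h. assert (r := core_remainder_set).
  apply is_top_iff in h; [|apply pair_in_EP; auto].
  apply sub_le in h; auto using pair_in_EP. destruct h as [_ h]. apply n.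
  apply (h a b (exist _ _ (ex_intro _ a (conj (or_intror ca) eq_refl)))); apply pair_lim; auto.
  cbn. apply collapse_map_eq; auto.
Qed.

(** A limit in [X] is attained only at the point itself, so a limit shared by two points is off [X].
    Both points are then off [X], and they are not in L by assumption. *)
Lemma lim_eq_core E p p' y : in_EP P E ->
  (forall q, lambda_rest q -> ~ exists y, lim e E q y) ->
  p <> p' -> lim e E p y -> lim e E p' y -> core p /\ core p'.
Proof.
  intros hE dom n l l'. assert (xE := EP_ext E hE).
  assert (ny : ~ image (ext_emb E) y).
  { intros [x <-]. apply n.
    rewrite (lim_at_emb X B e SC E xE p x l), (lim_at_emb X B e SC E xE p' x l'); auto. }
  assert (off : forall r, lim e E r y -> ~ image e r).
  { intros r lr [x <-]. apply ny. exists x.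
    apply (lim_unique X B e SC E xE (e x)); auto. apply lim_emb; auto. }
  split; eapply lim_in_core; eauto.
Qed.

Lemma adding_coatom_is_core_add c : adding_coatom P c ->
  exists q, lambda_rest q /\ ext_le c (sub_ext (core_add q)) /\ ext_le (sub_ext (core_add q)) c.
Proof.
  intros (Ec & nt & b & Eb & bc & ncb & between).
  assert (rc := core_remainder_set).
  destruct (classic (exists q, lambda_rest q /\ exists y, lim e c q y)) as [(q & hq & hy)|dom].
  - exists q. split; [auto|].
    (* M + q lies above c, hence in the interval above b. It is not below b, since then c would be,
       and it is not the top; so it is equivalent to c. *)
    assert (Eq := sub_in_EP _ (core_add_remainder_set q hq)).
    assert (cq : ext_le c (sub_ext (core_add q))) by (apply le_core_add; auto).
    destruct (between (sub_ext (core_add q))) as [h|[[h1 h2]|h]]; auto.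
    + eapply ext_le_trans; eauto.
    + exfalso. apply ncb. eapply ext_le_trans; eauto.
    + destruct (core_add_not_top q hq h).
  - exfalso.
    assert (domc : forall q, lambda_rest q -> ~ exists y, lim e c q y).
    { intros q hq hy. apply dom. exists q; auto. }
    (* With no limits on L, c differs from the top only by gluing points. *)
    assert (pair : exists x x' y, x <> x' /\ lim e c x y /\ lim e c x' y).
    { apply NNPP; intro n. apply nt. apply is_top_iff; auto. apply sub_le; auto. split.
      - intros p y l. destruct (classic (image e p)) as [h|h]; [left; auto|right].
        eapply lim_in_core; eauto.
      - intros p p' y l l'. apply NNPP; intro m. apply n. exists p, p', y; auto. }
    destruct pair as (x & x' & y & nx & lx & lx').
    assert (no : forall a, in_EP P a -> ext_le b a -> ~ is_top P a -> ext_le a c).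
    { intros a Ea ba na. destruct (between a Ea ba) as [h|[[h _]|h]]; auto; [|tauto].
      eapply ext_le_trans; eauto. }
    destruct (classic (exists q, lambda_rest q /\ exists y, lim e b q y)) as [(q & hq & hy)|domb].
    + assert (rq := core_add_remainder_set q hq).
      (* M + q is above b and not the top, so it would be below c; but an extension above M + q
         glues nothing, and c glues [x] with [x']. *)
      assert (h : ext_le (sub_ext (core_add q)) c).
      { apply no; auto using sub_in_EP, core_add_not_top. apply le_core_add; auto. }
      apply sub_le in h; auto. destruct h as [_ h]. apply nx. eapply h; eauto.
    + assert (dombq : forall q, lambda_rest q -> ~ exists y, lim e b q y).
      { intros q hq hy. apply domb. exists q; auto. }
      (* Here b has no limits on L, so c fails to be below b only because some fibre of b is not
         contained in a fibre of c. *)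
      assert (w : exists z z' w u, lim e b z w /\ lim e b z' w /\ lim e c z u /\ ~ lim e c z' u).
      { apply NNPP; intro n. apply ncb.
        apply (ext_le_lim X B e SC); auto using EP_ext. intro w.
        destruct (lim_surjective X B e SC b (EP_ext b Eb) w) as [z lz].
        assert (u : exists u, lim e c z u).
        { apply (lim_on_with_X c core); auto using EP_lim_core.
          destruct (classic (image e z)) as [h|h]; [left; auto|right].
          apply (lim_in_core b z w); auto. }
        destruct u as [u lu]. exists u. intros z' lz'. apply NNPP; intro m.
        apply n. exists z, z', w, u; auto. }
      destruct w as (z & z' & w & u & lz & lz' & lu & nlu).
      assert (nz : z <> z') by (intros ->; auto).
      destruct (lim_eq_core b z z' w) as [cz cz']; auto.
      assert (h : ext_le (pair_ext core z z') c).
      { apply no; auto using pair_in_EP, core_pair_not_top. apply le_pair; auto using EP_lim_core.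
        exists w; auto. }
      apply pair_le in h; auto. destruct h as [_ h].
      assert (uniq : forall p v v', lim e c p v -> lim e c p v' -> v = v').
      { intros p v v'. apply (lim_unique X B e SC c (EP_ext c Ec)). }
      (* c glues at most [z] with [z'], yet it glues [x] with [x']; so the two pairs agree and [z],
         [z'] have a common limit in c, against their choice. *)
      destruct (h x x' y lx lx') as [k|[[->| ->] [->| ->]]]; auto.
      * apply nlu. rewrite (uniq z u y); auto.
      * apply nlu. rewrite (uniq z u y); auto.
Qed.

Lemma core_add_inj q q' : lambda_rest q -> lambda_rest q' ->
  ext_le (sub_ext (core_add q)) (sub_ext (core_add q')) -> q = q'.
Proof.
  intros hq hq' h. assert (rq := core_add_remainder_set q hq).
  apply le_core_add in h; auto using sub_in_EP. destruct h as [y l].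
  apply sub_lim in l; auto. destruct y as [t (p & Np & hp)]. cbn in *. subst.
  destruct Np as [k|[k|k]]; [|destruct (k (proj1 hq'))|auto]. destruct (proj2 hq' k).
Qed.

(** * Closed subsets of the lambda-remainder *)

Lemma closed_trace_of_ext E : in_EP P E ->
  closed (fun q : lambda_remainder P e => ext_le E (sub_ext (core_add (proj1_sig q)))).
Proof.
  intro hE.
  assert (c := limit_domain_closed X B e SC E (EP_ext E hE) (proj2 (proj2 hE)) (image_open X B e SC lc)).
  eapply closed_ext; [exact (continuous_closed _ _ (incl_continuous (fun q => lambdaP P e q /\ ~ image e q)) c)|].
  intros [q hq]; cbn. rewrite (le_core_add E q) by auto. pose proof (proj2 hq). tauto.
Qed.

Lemma ext_of_closed_trace (C : lambda_remainder P e -> Prop) : closed C ->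
  exists E, in_EP P E /\ forall q, C q <-> ext_le E (sub_ext (core_add (proj1_sig q))).
Proof.
  intro cC. destruct (sub_closed_trace _ _ cC) as (D & cD & hD).
  (* [D] may meet [X]. Removing [X] keeps it closed because [X] is open in [B], and adding M does
     not change the trace on L. *)
  set (K := fun p => core p \/ (D p /\ ~ image e p)).
  assert (rK : remainder_set K).
  { split; [|split].
    - apply closed_or; [apply core_remainder_set|]. apply closed_and; auto.
      apply closed_compl, image_open; auto.
    - intros p h; left; auto.
    - intros p [h|[_ h]]; auto. apply core_off_X; auto. }
  exists (sub_ext K). split; [apply sub_in_EP; auto|]. intros [q hq]. cbn.
  rewrite le_core_add by auto using sub_in_EP. rewrite hD. cbn. split.
  - intro Dq. assert (Kq : K q) by (right; split; [auto|apply hq]).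
    exists (exist _ q (ex_intro _ q (conj (or_intror Kq) eq_refl))). apply sub_lim; auto.
  - intros [y l]. apply sub_lim in l; auto. destruct y as [t (p & Np & hp)]. cbn in *. subst.
    destruct Np as [k|[k|[k _]]]; [|destruct (k (proj1 hq))|auto]. destruct (proj2 hq k).
Qed.

End Points.

(** * Transport along an order isomorphism *)

(** A relation in place of the map on representatives: it is symmetric in [X] and [Y], so each
    transport result is proved once and used both ways without choosing an inverse. *)
Record order_correspondence (P : Top -> Prop) (X Y : Top) (R : Ext X -> Ext Y -> Prop) : Prop := {
  oc_EP : forall A A', R A A' -> in_EP P A /\ in_EP P A';
  oc_total : forall A, in_EP P A -> exists A', R A A';
  oc_onto : forall A', in_EP P A' -> exists A, R A A';
  oc_le : forall A A' C C', R A A' -> R C C' -> (ext_le A C <-> ext_le A' C')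
}.

Lemma order_correspondence_sym P X Y R :
  order_correspondence P X Y R -> order_correspondence P Y X (fun A' A => R A A').
Proof.
  intros [h1 h2 h3 h4]. split; auto.
  - intros A A' r. apply and_comm; auto.
  - intros A A' C C' r r'. symmetry; auto.
Qed.

Lemma EP_order_isomorphic_correspondence P X Y :
  EP_order_isomorphic P X Y -> exists R, order_correspondence P X Y R.
Proof.
  intros (Phi & h1 & _ & h3 & h4).
  (* [A] is related to every extension that lies below and above [Phi A], which absorbs the choice
     of representatives. *)
  exists (fun A A' => in_EP P A /\ in_EP P A' /\ ext_le (Phi A) A' /\ ext_le A' (Phi A)). split.
  - tauto.
  - intros A hA. exists (Phi A). auto using ext_le_refl.
  - intros A' hA'. destruct (h4 A' hA') as (A & hA & eq). exists A.
    destruct (ext_equiv_le _ _ eq). auto.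
  - intros A A' C C' (EA & _ & a & a') (EC & _ & c & c'). rewrite (h3 A C EA EC). split; intro h.
    + exact (ext_le_trans _ _ _ a' (ext_le_trans _ _ _ h c)).
    + exact (ext_le_trans _ _ _ a (ext_le_trans _ _ _ h c')).
Qed.

Lemma correspondence_top P X Y R A A' : order_correspondence P X Y R -> R A A' ->
  is_top P A -> is_top P A'.
Proof.
  intros oc r [_ h]. destruct (oc_EP _ _ _ _ oc _ _ r) as [_ EA']. split; [auto|]. intros C' EC'.
  destruct (oc_onto _ _ _ _ oc C' EC') as [C rC]. apply (oc_le _ _ _ _ oc C C' A A' rC r).
  apply h. exact (proj1 (oc_EP _ _ _ _ oc _ _ rC)).
Qed.

Lemma correspondence_top_iff P X Y R A A' : order_correspondence P X Y R -> R A A' ->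
  (is_top P A <-> is_top P A').
Proof.
  intros oc r. split; [apply (correspondence_top P X Y R A A' oc r)|].
  apply (correspondence_top P Y X _ A' A (order_correspondence_sym _ _ _ _ oc) r).
Qed.

Lemma correspondence_adding_coatom P X Y R c c' : order_correspondence P X Y R -> R c c' ->
  adding_coatom P c -> adding_coatom P c'.
Proof.
  intros oc r (Ec & nt & b & Eb & bc & ncb & between).
  destruct (oc_EP _ _ _ _ oc _ _ r) as [_ Ec']. split; [auto|].
  split; [rewrite <- (correspondence_top_iff P X Y R c c' oc r); auto|].
  destruct (oc_total _ _ _ _ oc b Eb) as [b' rb]. assert (le := oc_le _ _ _ _ oc).
  exists b'. split; [exact (proj2 (oc_EP _ _ _ _ oc _ _ rb))|].
  split; [apply (le b b' c c' rb r); auto|].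
  split; [intro h; apply ncb, (le c c' b b' r rb); auto|].
  intros a' Ea' ba'. destruct (oc_onto _ _ _ _ oc a' Ea') as [a ra].
  rewrite <- (le a a' b b' ra rb), <- (le a a' c c' ra r), <- (le c c' a a' r ra),
    <- (correspondence_top_iff P X Y R a a' oc ra).
  apply between; [exact (proj1 (oc_EP _ _ _ _ oc _ _ ra))|]. apply (le b b' a a' rb ra); auto.
Qed.

(** Comparing what lies below M + q and below its counterpart depends only on their classes, whether
    or not these two representatives are themselves related by [R]. *)
Definition corresponding_points (P : Top -> Prop) {X Y BX BY : Top} (eX : X -> BX) (eY : Y -> BY)
    (R : Ext X -> Ext Y -> Prop) (q : lambda_remainder P eX) (q' : lambda_remainder P eY) : Prop :=
  forall A A', R A A' ->
    (ext_le A (sub_ext X BX eX (core_add P X BX eX (proj1_sig q))) <->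
     ext_le A' (sub_ext Y BY eY (core_add P Y BY eY (proj1_sig q')))).

Lemma corresponding_points_unique P (X Y BX BY : Top) (eX : X -> BX) (eY : Y -> BY) R q q1 q2 :
  compactness_like P -> tychonoff Y -> locally_P P Y -> ~ P Y ->
  is_stone_cech eY -> order_correspondence P X Y R ->
  corresponding_points P eX eY R q q1 -> corresponding_points P eX eY R q q2 -> q1 = q2.
Proof.
  intros HP tY lP nP SC oc c1 c2. apply sig_eq.
  apply (core_add_inj P Y BY eY HP tY lP nP SC); [apply (proj2_sig q1)|apply (proj2_sig q2)|].
  destruct (oc_onto _ _ _ _ oc (sub_ext Y BY eY (core_add P Y BY eY (proj1_sig q1)))) as [A r].
  - apply sub_in_EP; auto. apply core_add_remainder_set; auto. apply (proj2_sig q1).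
  - apply (c2 _ _ r), (c1 _ _ r), ext_le_refl.
Qed.

Lemma corresponding_points_map P (X Y BX BY : Top) (eX : X -> BX) (eY : Y -> BY) R :
  compactness_like P ->
  tychonoff X -> locally_compact X -> locally_P P X -> ~ P X -> is_stone_cech eX ->
  tychonoff Y -> locally_compact Y -> locally_P P Y -> ~ P Y -> is_stone_cech eY ->
  order_correspondence P X Y R ->
  exists f : lambda_remainder P eX -> lambda_remainder P eY,
    continuous f /\ forall q, corresponding_points P eX eY R q (f q).
Proof.
  intros HP tX lcX lPX nPX SCX tY lcY lPY nPY SCY oc.
  assert (H : forall q, exists q', corresponding_points P eX eY R q q').
  { intros [q hq].
    assert (ac := core_add_adding_coatom P X BX eX HP tX lPX nPX SCX q hq).
    destruct (oc_total _ _ _ _ oc _ (proj1 ac)) as [c' r].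
    destruct (adding_coatom_is_core_add P Y BY eY HP tY lPY nPY SCY c'
      (correspondence_adding_coatom P X Y R _ _ oc r ac)) as (q' & hq' & h1 & h2).
    exists (exist _ q' hq'). intros A A' rA. cbn. rewrite (oc_le _ _ _ _ oc _ _ _ _ rA r).
    split; intro h; eapply ext_le_trans; eauto. }
  set (f := fun q => proj1_sig (constructive_indefinite_description _ (H q))).
  assert (hf : forall q, corresponding_points P eX eY R q (f q)).
  { intro q. unfold f. apply proj2_sig. }
  exists f. split; [|exact hf]. intros V oV.
  (* The complement of [V] is the trace of some [E']. Its preimage under [f] is the trace of a
     related [E], and traces are closed. *)
  destruct (ext_of_closed_trace P Y BY eY HP tY lcY lPY nPY SCY (fun q => ~ V q) (closed_compl _ oV))
    as (E' & EE' & hE').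
  destruct (oc_onto _ _ _ _ oc E' EE') as [E r].
  assert (c := closed_trace_of_ext P X BX eX HP tX lcX lPX nPX SCX E (proj1 (oc_EP _ _ _ _ oc _ _ r))).
  eapply open_ext; [exact c|]. intro q. cbn. rewrite (hf q E E' r), <- hE'.
  split; [apply NNPP|tauto].
Qed.

Theorem theorem4p13 (P : Top -> Prop) (X Y : Top) :
  compactness_like P ->
  tychonoff X -> tychonoff Y ->
  locally_compact X -> locally_compact Y ->
  locally_P P X -> locally_P P Y ->
  ~ P X -> ~ P Y ->
  EP_order_isomorphic P X Y ->
  forall (BX : Top) (eX : X -> BX) (BY : Top) (eY : Y -> BY),
    is_stone_cech eX -> is_stone_cech eY ->
    homeomorphic (lambda_remainder P eX) (lambda_remainder P eY).
Proof.
  intros HP tX tY lcX lcY lPX lPY nPX nPY iso BX eX BY eY SCX SCY.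
  destruct (EP_order_isomorphic_correspondence P X Y iso) as [R oc].
  assert (co := order_correspondence_sym _ _ _ _ oc).
  destruct (corresponding_points_map P X Y BX BY eX eY R) as (f & cf & hf); auto.
  destruct (corresponding_points_map P Y X BY BX eY eX _ HP tY lcY lPY nPY SCY tX lcX lPX nPX SCX co)
    as (g & cg & hg).
  assert (sym : forall q q', corresponding_points P eX eY R q q' <->
            corresponding_points P eY eX (fun A' A => R A A') q' q).
  { intros q q'. split; intros h A A' r; symmetry; apply h; auto. }
  exists f, g. split; [auto|]. split; [auto|]. split.
  (* Both [g (f q)] and [q] correspond to [f q]. *)
  - intro q. apply (corresponding_points_unique P Y X BY BX eY eX (fun A' A => R A A') (f q));
      auto. apply sym, hf.
  - intro q. apply (corresponding_points_unique P X Y BX BY eX eY R (g q)); auto. apply sym, hg.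
Qed.
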